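(* For every real number $r$ with $1\le r<\infty$ there is a constant $K$ depending only on $r$ such that the following holds. Let $\Omega\subset\mathbb{C}$ be a simply connected domain with non-empty boundary, let $\varphi:\Omega\to\mathbb{D}$ be a conformal homeomorphism of $\Omega$ onto the unit disc $\mathbb{D}$, and let $h(z)=J(z,\varphi)=|\varphi'(z)|^2$. Then for every function $f\in C_0^\infty(\Omega)$, $$\Bigl(\int_\Omega |f(z)|^r h(z)\,d\mu\Bigr)^{1/r}\le K\Bigl(\int_\Omega|\nabla f(z)|^2\,d\mu\Bigr)^{1/2}.$$
   Context: $\mu$ is Lebesgue measure on $\mathbb{C}\cong\mathbb{R}^2$; $\mathbb{D}$ is the open unit disc in $\mathbb{C}$. Functions $f$ are real-valued, and $\nabla f=(\partial f/\partial x,\partial f/\partial y)$ with $z=x+iy$. $C_0^\infty(\Omega)$ is the space of smooth functions with compact support in $\Omega$. $J(z,\varphi)$ is the Jacobian of $\varphi$ at $z$. The function $h$ is called the universal conformal weight on $\Omega$. *)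

(* Defs.v *)
From HB Require Import structures.
From mathcomp Require Import all_boot all_order all_algebra complex.
From mathcomp Require Import all_classical all_reals all_analysis.

Set Implicit Arguments.
Unset Strict Implicit.
Unset Printing Implicit Defensive.

Import Order.TTheory GRing.Theory Num.Theory numFieldNormedType.Exports.

Local Open Scope classical_set_scope.
Local Open Scope complex_scope.
Local Open Scope ring_scope.

(* The topology and the normed-module structure over itself are attached to
   the regular copy [_^o] of the field of complex numbers; with domain
   [cplx R], [derivable] and [derive1] are complex differentiability and the
   complex derivative. *)
Notation cplx R := (GRing.regular (complex R)).

Section ComplexPlane.
Context {R : realType}.
Implicit Types (A B Omega : set (cplx R)) (phi : cplx R -> cplx R)
  (f : cplx R -> R) (z w : cplx R).

Definition unit_disc : set (cplx R) := [set z | ComplexField.Normc.normc z < 1].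

Definition is_domain Omega := [/\ open Omega, connected Omega & Omega !=set0].

Definition boundary A : set (cplx R) := closure A `\` A°.

Definition is_loop_in A (gamma : R -> cplx R) :=
  [/\ {within `[0, 1], continuous gamma}, gamma @` `[0, 1] `<=` A &
      gamma 0 = gamma 1].

(* [H s] is the loop at time [s] of a base-point preserving contraction. *)
Definition null_homotopic_in A (gamma : R -> cplx R) :=
  exists H : R * R -> cplx R,
    [/\ {within `[0, 1] `*` `[0, 1], continuous H},
        H @` (`[0, 1] `*` `[0, 1]) `<=` A,
        forall t : R, t \in `[0, 1] -> H (0, t) = gamma t,
        forall t : R, t \in `[0, 1] -> H (1, t) = gamma 0 &
        forall s : R, s \in `[0, 1] -> H (s, 0) = gamma 0 /\ H (s, 1) = gamma 0].

Definition simply_connected_domain Omega :=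
  is_domain Omega /\
  forall gamma, is_loop_in Omega gamma -> null_homotopic_in Omega gamma.

Definition homeomorphism A B phi :=
  [/\ set_bij A B phi, {within A, continuous phi} &
      exists2 psi : cplx R -> cplx R,
        {in A, cancel phi psi} & {within B, continuous psi}].

Definition conformal_homeomorphism A B phi :=
  homeomorphism A B phi /\
  forall z, A z -> derivable phi z 1 /\ derive1 phi z != 0.

Definition derivable_x f z :=
  derivable (fun t : R => f (t +i* complex.Im z)) (complex.Re z) 1.
Definition derivable_y f z :=
  derivable (fun t : R => f (complex.Re z +i* t)) (complex.Im z) 1.

Definition partial_x f z : R :=
  derive1 (fun t : R => f (t +i* complex.Im z)) (complex.Re z).
Definition partial_y f z : R :=
  derive1 (fun t : R => f (complex.Re z +i* t)) (complex.Im z).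

Definition gradient f z : R * R := (partial_x f z, partial_y f z).

(* The library norm of [R * R] is the maximum norm. *)
Definition enorm (v : R * R) : R := Num.sqrt (v.1 ^+ 2 + v.2 ^+ 2).

Fixpoint class_C (k : nat) f : Prop :=
  continuous f /\
  if k is j.+1 then
    [/\ forall z, derivable_x f z, forall z, derivable_y f z,
        class_C j (partial_x f) & class_C j (partial_y f)]
  else True.

Definition smooth f := forall k, class_C k f.

Definition tsupport f : set (cplx R) := closure [set z | f z != 0].

(* A compactly supported function on [Omega] is represented by its extension
   by zero to the plane. *)
Definition C0infty Omega f :=
  [/\ smooth f, compact (tsupport f) & tsupport f `<=` Omega].

(* Determinant of the real 2 x 2 Jacobian matrix of [phi]. *)
Definition jacobian_det phi z : R :=
  let u w := complex.Re (phi w) in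
  let v w := complex.Im (phi w) in
  partial_x u z * partial_y v z - partial_y u z * partial_x v z.

Definition conformal_weight phi : cplx R -> R := jacobian_det phi.

Let ReIm_cvg (g : R -> cplx R) (l : cplx R) :
  g t @[t --> (0 : R)^'] --> l ->
  (complex.Re (g t) @[t --> (0 : R)^'] --> complex.Re l) /\
  (complex.Im (g t) @[t --> (0 : R)^'] --> complex.Im l).
Proof.
move=> gl; split; apply/cvgrPdist_lt => e e0;
  have e0' : 0 < e%:C :> R[i] by rewrite ltcR.
- move/cvgrPdist_lt : gl => /(_ _ e0'); apply: filterS => t.
  rewrite -raddfB -ltcR; apply: le_lt_trans; exact: normc_ge_Re.
- move/cvgrPdist_lt : gl => /(_ _ e0'); apply: filterS => t.
  rewrite normc_def ltcR; apply: le_lt_trans.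
  by rewrite -raddfB -sqrtr_sqr ler_wsqrtr// lerDr sqr_ge0.
Qed.

Let slice_cvg phi z w : w != 0 -> derivable phi z 1 ->
  (t%:C^-1 * (phi (t%:C * w + z) - phi z) : cplx R) @[t --> (0 : R)^'] -->
  (w * derive1 phi z : cplx R).
Proof.
move=> w0 dphi.
have nw0 : 0 < complex.Re `|w| by rewrite -ltcR RRe_real ?normr_real// normr_gt0.
have twc : (t%:C * w : cplx R) @[t --> (0 : R)^'] --> (0 : cplx R)^'.
  move=> U /nbhs_ballP[e /= e0 eU].
  have er : (complex.Re e)%:C = e by rewrite RRe_real ?gtr0_real.
  have e0' : 0 < complex.Re e by rewrite -ltcR er.
  have d0 : 0 < complex.Re e / complex.Re `|w| by rewrite divr_gt0.
  apply/nbhs_ballP; exists (complex.Re e / complex.Re `|w|) => //= t /=.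
  rewrite /ball/= sub0r normrN => te t0; apply: eU.
    rewrite /ball/= sub0r normrN normrM -[`|w|]RRe_real ?normr_real//.
    rewrite -er normc_def/= expr0n/= addr0 sqrtr_sqr -rmorphM ltcR.
    by rewrite -ltr_pdivlMr.
  by rewrite mulf_neq0//; apply: contra_neq t0 => -[].
have := cvg_comp _ _ twc (dphi : _ --> _).
move=> /(cvgM (cvg_cst w)) /=.
rewrite derive1E /derive.
apply: cvg_trans; apply: near_eq_cvg; apply: nearW => t /=.
rewrite [X in phi (X + z)](_ : _ = t%:C * w); last exact: mulr1.
by rewrite /GRing.scale/= invfM mulrA mulrCA mulfV// mulr1.
Qed.

Lemma conformal_weightE phi z : derivable phi z 1 ->
  conformal_weight phi z = ComplexField.Normc.normc (derive1 phi z) ^+ 2.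
Proof.
move=> dphi.
have i0 : 'i != 0 :> R[i] by rewrite eq_complex/= oner_eq0 andbF.
have [xr xi] := ReIm_cvg (slice_cvg (oner_neq0 _) dphi).
have [yr yi] := ReIm_cvg (slice_cvg i0 dphi).
have hx t : t%:C * 1 + z = (t + complex.Re z) +i* complex.Im z.
  by case: z {dphi xr xi yr yi} => a b; rewrite mulr1; simpc.
have hy t : t%:C * 'i + z = complex.Re z +i* (t + complex.Im z).
  by case: z {dphi xr xi yr yi hx} => a b; simpc.
have zE : z = complex.Re z +i* complex.Im z by case: (z).
have ReM (t : R) (u : R[i]) : complex.Re (t%:C^-1 * u) = t^-1 * complex.Re u.
  by rewrite -fmorphV/=; case: u => a b /=; rewrite mul0r subr0.
have ImM (t : R) (u : R[i]) : complex.Im (t%:C^-1 * u) = t^-1 * complex.Im u.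
  by rewrite -fmorphV/=; case: u => a b /=; rewrite mul0r addr0.
have ux : partial_x (fun w => complex.Re (phi w)) z =
    complex.Re (derive1 phi z).
  rewrite -[X in _ = complex.Re X]mul1r; apply: cvg_lim => //.
  apply: cvg_trans xr; apply: near_eq_cvg; apply: nearW => t /=.
  by rewrite ReM hx raddfB -zE.
have vx : partial_x (fun w => complex.Im (phi w)) z =
    complex.Im (derive1 phi z).
  rewrite -[X in _ = complex.Im X]mul1r; apply: cvg_lim => //.
  apply: cvg_trans xi; apply: near_eq_cvg; apply: nearW => t /=.
  by rewrite ImM hx raddfB -zE.
have uy : partial_y (fun w => complex.Re (phi w)) z =
    complex.Re ('i * derive1 phi z).
  apply: cvg_lim => //.
  apply: cvg_trans yr; apply: near_eq_cvg; apply: nearW => t /=.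
  by rewrite ReM hy raddfB -zE.
have vy : partial_y (fun w => complex.Im (phi w)) z =
    complex.Im ('i * derive1 phi z).
  apply: cvg_lim => //.
  apply: cvg_trans yi; apply: near_eq_cvg; apply: nearW => t /=.
  by rewrite ImM hy raddfB -zE.
rewrite /conformal_weight /jacobian_det ux vx uy vy; case: (derive1 phi z) => a b.
rewrite /ComplexField.Normc.normc sqr_sqrtr ?addr_ge0 ?sqr_ge0//=.
by rewrite !mul0r !mul1r sub0r add0r mulNr opprK !expr2.
Qed.
Definition of_plane (p : R * R) : cplx R := p.1 +i* p.2.

(* Integral against Lebesgue measure of the plane, [z = x + i y]. *)
Definition plane_integral A f : \bar R :=
  (\int[lebesgue_measure \x lebesgue_measure]_(p in of_plane @^-1` A)
    (f (of_plane p))%:E)%E.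

End ComplexPlane.

(* Main.v *)
Require Import Defs.
From mathcomp Require Import all_boot all_order all_algebra complex.
From mathcomp Require Import all_classical all_reals all_analysis.
From mathcomp Require Import measurable_realfun ring lra.

Set Implicit Arguments.
Unset Strict Implicit.
Unset Printing Implicit Defensive.

Import Order.TTheory GRing.Theory Num.Theory numFieldNormedType.Exports.
Local Open Scope classical_set_scope.
Local Open Scope ring_scope.

(** Let [psi] be the inverse of [phi] and let [g] be [f \o psi] on the disc and
    zero elsewhere. Since [h = |phi'|^2] is the Jacobian of [phi], the integral
    of [|f|^r h] over [Omega] is the integral of [|g|^r] over the disc, and the
    Dirichlet integrals of [f] and of [g] are equal. So the theorem is a Sobolev
    inequality for functions supported in the unit disc, with a constant that
    does not see [Omega].

    Only the existence of a constant is claimed, so each change of variables is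
    an inequality up to an absolute factor. In this form it depends only on the
    pointwise dilation of [phi]: near [p], [|phi q - phi p|] is comparable to
    [|phi' p| |q - p|]. The mechanism is the same in dimensions one and two. A
    countable partition ([uniform_pieces]) makes the dilation nearly constant
    and the pointwise estimate uniform on each piece; there the map is
    Lipschitz, or has a Lipschitz inverse, and changes measure by a controlled
    factor.
    - In dimension one this gives [increment_le_integral]: the increment of [p]
      is at most a multiple of the integral of any bound [L] of its pointwise
      Lipschitz constant.
    - In dimension two it gives [change_of_variables_le]. A piece is compared
      with its image on dyadic squares, where the bound is only a statement on
      diameters, and [le_measure_cells] extends the comparison to Borel sets.

    For the Sobolev inequality, integrate along the two axes: if [L] bounds the
    pointwise Lipschitz constant of [u], then [|u(x, y)|] is at most a multiple
    of [int L(t, y) dt] and of [int L(x, t) dt], and Fubini gives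
    [int u^2 <= 16 (int L)^2] ([gagliardo_nirenberg]). With [u = g^(m+1)] and
    [L = (m+1) |g|^m G], where [G] bounds the pointwise Lipschitz constant of
    [g] and [int G^2 <= 1], the right-hand side is controlled by [int g^(2m)],
    so induction on [m] bounds all even powers and hence every power [r]
    ([power_bound]). Homogeneity removes the normalization of [G]. *)

(** * Dyadic squares determine domination of Borel measures *)

Section DyadicCells.
Context {R : realType}.
Local Notation plane := (measurableTypeR R * measurableTypeR R)%type.
Implicit Types (x y : R) (p q : R * R) (E : set (R * R)).

Definition dyadic (n : nat) x : int := Num.floor (2 ^+ n * x).

Lemma dyadic_coarsen n x y : dyadic n.+1 x = dyadic n.+1 y -> dyadic n x = dyadic n y.
Proof.
have H (z : R) (m : int) : (m <= dyadic n z) = (2 * m <= dyadic n.+1 z).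
  rewrite /dyadic !floor_ge_int exprS -mulrA intrM /=.
  by rewrite ler_pM2l.
move=> e; apply/eqP; rewrite eq_le H -e -H lexx /=.
by rewrite H e -H lexx.
Qed.

Lemma dyadic_fiber n (k : int) :
  [set x | dyadic n x = k] = [set` `[k%:~R / 2 ^+ n, (k + 1)%:~R / 2 ^+ n[ ].
Proof.
have n0 : 0 < 2 ^+ n :> R by rewrite exprn_gt0.
apply/seteqP; split => x /=; rewrite in_itv/= /dyadic.
  by move=> /eqP; rewrite floor_eq ler_pdivrMr// ltr_pdivlMr// [x * _]mulrC.
by rewrite ler_pdivrMr// ltr_pdivlMr// [x * _]mulrC => H; apply/eqP; rewrite floor_eq.
Qed.

Lemma exprn2V_lt (e : R) : 0 < e -> exists n, (2 ^+ n)^-1 < e.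
Proof.
move=> e0.
have /cvgrPdist_lt /(_ _ e0) [n _ Hn] := @cvg_expr R 2^-1 ltac:(rewrite ger0_norm; lra).
exists n; have := Hn n (leqnn n); rewrite /= sub0r normrN ger0_norm ?exprn_ge0//.
by rewrite exprVn.
Qed.

Lemma dyadic_near x (e : R) : 0 < e ->
  exists n, forall y, dyadic n y = dyadic n x -> `|y - x| < e.
Proof.
move=> e0; have [n ne] := exprn2V_lt e0.
exists n => y yx; apply: le_lt_trans ne.
have n0 : 0 < 2 ^+ n :> R by rewrite exprn_gt0.
have Hx : [set z | dyadic n z = dyadic n x] x by [].
have Hy : [set z | dyadic n z = dyadic n x] y by [].
move: Hx Hy; rewrite dyadic_fiber/= !in_itv/= intrD mulrDl mul1r => /andP[a b] /andP[c d].
by rewrite ler_norml; apply/andP; split; lra.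
Qed.

Definition cell n (k : int * int) : set (R * R) :=
  [set p | (dyadic n p.1, dyadic n p.2) = k].

Lemma cellE n k : cell n k = [set x | dyadic n x = k.1] `*` [set x | dyadic n x = k.2].
Proof.
by case: k => a b; apply/seteqP; split => -[x y] /=; [case=> <- <-|case=> /= <- <-].
Qed.

Lemma measurable_cell n k : measurable (cell n k : set plane).
Proof. by rewrite cellE; apply: measurableX; rewrite dyadic_fiber; exact: measurable_itv. Qed.

(** A union of cells of level [n]. *)
Definition saturated n E := forall p q, 
  (dyadic n p.1, dyadic n p.2) = (dyadic n q.1, dyadic n q.2) -> E p -> E q.

Lemma saturatedS n E : saturated n E -> saturated n.+1 E.
Proof. by move=> sE p q [/dyadic_coarsen e1 /dyadic_coarsen e2]; apply: sE; congr pair. Qed.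

Lemma saturated_le n m E : (n <= m)%N -> saturated n E -> saturated m E.
Proof.
move=> /subnK <-; elim: (m - n)%N => // k ih /ih; rewrite addSn; exact: saturatedS.
Qed.


Definition cell_slice n E (i : nat) : set (R * R) :=
  if pickle_inv i is Some k then E `&` cell n k else set0.

Lemma bigcup_cell_slice n E : \bigcup_i cell_slice n E i = E.
Proof.
apply/seteqP; split => [p [i _]|p Ep].
  by rewrite /cell_slice; case: (pickle_inv i) => // k [].
by exists (pickle (dyadic n p.1, dyadic n p.2)); [exact: I|rewrite /cell_slice pickleK_inv].
Qed.

Lemma trivIset_cell_slice n E : trivIset setT (cell_slice n E).
Proof.
apply/trivIsetP => i j _ _ /eqP ij; apply/seteqP; split => // p.
rewrite /cell_slice.
case ei: (pickle_inv i) => [k|]; last by case.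
case ej: (pickle_inv j) => [l|]; last by case.
case=> -[_ pk] [_ pl]; apply: ij.
have := @pickle_invK (int * int)%type i; have := @pickle_invK (int * int)%type j.
by rewrite ei ej /= -[k]pk -[l]pl => <- <-.
Qed.

Lemma cell_slice_saturated n E i : saturated n E ->
  cell_slice n E i = set0 \/ exists k, cell_slice n E i = cell n k.
Proof.
move=> sE; rewrite /cell_slice; case: (pickle_inv i) => [k|]; last by left.
have [->|/set0P[p [Ep pk]]] := eqVneq (E `&` cell n k) set0; [by left|right].
exists k; apply/setIidPr => q qk; apply: sE Ep.
by rewrite [LHS]pk -[LHS]qk.
Qed.

Lemma measurable_saturated n E : saturated n E -> measurable (E : set plane).
Proof.
move=> sE; rewrite -(bigcup_cell_slice n E); apply: bigcupT_measurable => i.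
by have [->|[k ->]] := cell_slice_saturated i sE; [exact: measurable0|exact: measurable_cell].
Qed.

Lemma open_bigcup_saturated (U : set (R * R)) : open U ->
  exists F : nat -> set (R * R), (forall n, saturated n (F n)) /\ U = \bigcup_n F n.
Proof.
move=> oU.
exists (fun n => [set p | forall q,
  (dyadic n p.1, dyadic n p.2) = (dyadic n q.1, dyadic n q.2) -> U q]).
split=> [n p q e Fp r er|]; first by apply: Fp; rewrite e.
apply/seteqP; split=> [p Up|p [n _]]; last exact.
move: oU; rewrite openE => /(_ _ Up)/nbhs_ballP[e /= e0 be].
have [n1 h1] := dyadic_near p.1 e0.
have [n2 h2] := dyadic_near p.2 e0.
have up m n x y : (n <= m)%N -> dyadic m x = dyadic m y -> dyadic n x = dyadic n y.
  by move=> /subnK <-; elim: (m - n)%N => // k ih; rewrite addSn => /dyadic_coarsen.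
exists (maxn n1 n2) => // q [e1 e2]; apply: be; split; rewrite /ball/= distrC.
  by apply/h1/esym/(up (maxn n1 n2)) => //; exact: leq_maxl.
by apply/h2/esym/(up (maxn n1 n2)) => //; exact: leq_maxr.
Qed.

Lemma open_measurable_plane (U : set (R * R)) : open U -> measurable (U : set plane).
Proof.
move=> /open_bigcup_saturated[F [sF ->]]; apply: bigcupT_measurable => n.
exact: measurable_saturated (sF n).
Qed.

Definition dyadic_sets : set (set (R * R)) := [set E | exists n, saturated n E].

Lemma setring_dyadic_sets : setring dyadic_sets.
Proof.
split; first by exists 0%N.
- move=> A B [n sA] [m sB]; exists (maxn n m) => p q e.
  have sA' := saturated_le (leq_maxl n m) sA; have sB' := saturated_le (leq_maxr n m) sB.
  by move=> [?|?]; [left; exact: sA' e _|right; exact: sB' e _].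
- move=> A B [n sA] [m sB]; exists (maxn n m) => p q e.
  have sA' := saturated_le (leq_maxl n m) sA; have sB' := saturated_le (leq_maxr n m) sB.
  move=> [Ap nBp]; split; first exact: sA' e _.
  by move=> Bq; apply: nBp; exact: sB' (esym e) _.
Qed.

(** A half plane is the increasing union over [n] of the union of the cells of
    level [n] that lie to the right of its boundary line. *)
Lemma measurable_sub_sigma_ring : (@measurable _ plane) `<=` <<sr dyadic_sets >>.
Proof.
have [S0 SD SU] := @smallest_sigma_ring _ dyadic_sets.
have ST : <<sr dyadic_sets >> [set: R * R].
  by apply: sub_g_sigma_ring; exists 0%N => p q.
have SC A : <<sr dyadic_sets >> A -> <<sr dyadic_sets >> (~` A).
  by move=> SA; rewrite -setTD; exact: SD.
have sub (f : R * R -> R) :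
    (forall n p q, (dyadic n p.1, dyadic n p.2) = (dyadic n q.1, dyadic n q.2) ->
       dyadic n (f p) = dyadic n (f q)) ->
  forall B : set R, measurable B -> <<sr dyadic_sets >> (f @^-1` B).
  move=> hf.
  rewrite -[measurable]/((@ocitv R).-sigma.-measurable) RGenOInfty.measurableE.
  apply: smallest_sub.
    split; first by rewrite preimage_set0.
    - by move=> A; rewrite setTD preimage_setC; exact: SC.
    - by move=> A SA; rewrite preimage_bigcup; exact: SU.
  move=> _ [a ->].
  have -> : f @^-1` [set` `]a, +oo[ ] = \bigcup_n [set p | a < (dyadic n (f p))%:~R / 2 ^+ n].
    apply/seteqP; split => p /=; last first.
      case=> n _ /= h; rewrite in_itv/= andbT; apply: lt_le_trans h _.
      by rewrite ler_pdivrMr ?exprn_gt0// mulrC; exact: floor_le.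
    rewrite in_itv/= andbT => afp.
    have e0 : 0 < f p - a by rewrite subr_gt0.
    have [n ne] := exprn2V_lt e0.
    exists n => //=.
    have n0 : 0 < 2 ^+ n :> R by rewrite exprn_gt0.
    have := floorD1_gt (2 ^+ n * f p); rewrite -/(dyadic n (f p)) intrD.
    rewrite mulrC -ltr_pdivlMr// mulrDl mul1r; lra.
  apply: SU => n; apply: sub_g_sigma_ring; exists n => p q e /=.
  by rewrite (hf _ _ _ e).
apply: smallest_sub; first by split => // A SA; rewrite setTD; exact: SC.
move=> _ [[B mB <-]|[B mB <-]]; rewrite setTI; apply: sub mB => n p q.
  by case.
by case.
Qed.

Local Open Scope ereal_scope.

Lemma le_measure_saturated (mu rho : {measure set plane -> \bar R}) (c : R) n E :
  (0 <= c)%R -> (forall k, rho (cell n k) <= c%:E * mu (cell n k)) ->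
  saturated n E -> rho E <= c%:E * mu E.
Proof.
move=> c0 h sE.
have mF i : measurable (cell_slice n E i : set plane).
  by have [->|[k ->]] := cell_slice_saturated i sE; [exact: measurable0|exact: measurable_cell].
rewrite -(bigcup_cell_slice n E) !measure_bigcup//=; last 2 first.
- exact: trivIset_cell_slice.
- exact: trivIset_cell_slice.
rewrite -nneseriesZl; last by move=> *; exact: measure_ge0.
apply: lee_nneseries => [*|i _]; first exact: measure_ge0.
have [->|[k ->]] := cell_slice_saturated i sE; last exact: h.
by rewrite !measure0 mule0.
Qed.

(** A set saturated at some level is a countable disjoint union of cells, so
    it satisfies the inequality. These sets form a ring that generates the Borel
    sets, and inside a cell of level [0], where both measures are finite, the
    inequality passes to monotone limits; the monotone class theorem
    concludes. *)
Lemma le_measure_cells (mu rho : {measure set plane -> \bar R}) (c : R) :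
  (0 <= c)%R -> (forall n k, rho (cell n k) <= c%:E * mu (cell n k)) ->
  (forall k, mu (cell 0 k) < +oo) ->
  forall E, measurable (E : set plane) -> rho E <= c%:E * mu E.
Proof.
move=> c0 h fin.
have sat0 k : saturated 0 (cell 0 k) by move=> p q e; rewrite /cell/= e.
have key k E : measurable E -> rho (E `&` cell 0 k) <= c%:E * mu (E `&` cell 0 k).
  move=> /measurable_sub_sigma_ring SE.
  pose G := [set E | @measurable _ plane E /\ rho (E `&` cell 0 k) <= c%:E * mu (E `&` cell 0 k)].
  suff /(_ _ SE) [] : <<sr dyadic_sets >> `<=` G by [].
  have mC : @measurable _ plane (cell 0 k) := measurable_cell 0 k.
  apply: monotone_setring_sub_g_sigma_ring; last 2 first.
  - exact: setring_dyadic_sets.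
  - move=> A [n sA]; split; first exact: measurable_saturated sA.
    apply: (@le_measure_saturated _ _ _ n) => // p q e [Ap pk]; split; first exact: sA e Ap.
    by apply: saturated_le (sat0 k) _ _ e pk.
  have finr : rho (cell 0 k) < +oo.
    by apply: le_lt_trans (h _ _) _; rewrite lte_mul_pinfty// ge0_fin_numE//; exact: fin.
  split => F mF GF.
  - have mFk i : measurable (F i `&` cell 0 k : set plane) by apply: measurableI => //; case: (GF i).
    have mU : @measurable _ plane (\bigcup_i F i) by apply: bigcupT_measurable => i; case: (GF i).
    split => //; rewrite setI_bigcupl.
    have ndF : {homo (fun i => F i `&` cell 0 k) : n m / (n <= m)%N >-> (n <= m)%O}.
      by move=> i j ij; apply/subsetPset; apply: setSI; apply/subsetPset/mF.
    have mU' : @measurable _ plane (\bigcup_i (F i `&` cell 0 k)) by exact: bigcupT_measurable.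
    have cr := nondecreasing_cvg_mu (mu := rho) mFk mU' ndF.
    have cm := nondecreasing_cvg_mu (mu := mu) mFk mU' ndF.
    have cm' := cvgeZl (isT : c%:E \is a fin_num) cm.
    by apply: (lee_cvg_to cr cm') => //; exact: nearW (fun i => (GF i).2).
  - have mFk i : measurable (F i `&` cell 0 k : set plane) by apply: measurableI => //; case: (GF i).
    have mU : @measurable _ plane (\bigcap_i F i) by apply: bigcapT_measurable => i; case: (GF i).
    split => //.
    have -> : \bigcap_i F i `&` cell 0 k = \bigcap_i (F i `&` cell 0 k).
      apply/seteqP; split => p /=; first by move=> [a b] i _; split => //; exact: a.
      by move=> a; split => [i _|]; [exact: (a i I).1|exact: (a 0%N I).2].
    have niF : {homo (fun i => F i `&` cell 0 k) : n m / (n <= m)%N >-> (n >= m)%O}.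
      by move=> i j ij; apply/subsetPset; apply: setSI; apply/subsetPset/mF.
    have mU' : @measurable _ plane (\bigcap_i (F i `&` cell 0 k)) by exact: bigcapT_measurable.
    have cr := nonincreasing_cvg_mu (mu := rho) (F := fun i => F i `&` cell 0 k) _ mFk mU' niF.
    have cm := nonincreasing_cvg_mu (mu := mu) (F := fun i => F i `&` cell 0 k) _ mFk mU' niF.
    have {}cr := cr ltac:(by apply: le_lt_trans finr;
      apply: le_measure; rewrite ?inE//; exact: subIsetr).
    have {}cm := cm ltac:(by apply: le_lt_trans (fin k);
      apply: le_measure; rewrite ?inE//; exact: subIsetr).
    have cm' := cvgeZl (isT : c%:E \is a fin_num) cm.
    by apply: (lee_cvg_to cr cm') => //; exact: nearW (fun i => (GF i).2).
move=> E mE.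
have mF i : measurable (cell_slice 0 E i : set plane).
  by rewrite /cell_slice; case: (pickle_inv i) => [k|//]; exact: measurableI (measurable_cell _ _).
rewrite -(bigcup_cell_slice 0 E) !measure_bigcup//=; last 2 first.
- exact: trivIset_cell_slice.
- exact: trivIset_cell_slice.
rewrite -nneseriesZl; last by move=> *; exact: measure_ge0.
apply: lee_nneseries => [*|i _]; first exact: measure_ge0.
rewrite /cell_slice; case: (pickle_inv i) => [k|]; first exact: key.
by rewrite !measure0 mule0.
Qed.

End DyadicCells.

(** * Countable pieces on which a pointwise estimate is uniform *)

Section Pieces.
Context {R : realType}.

(** Turns an estimate [rel] that holds near each point, on a neighbourhood that
    depends on the point, into one that holds between any two points of a piece.
    A piece is cut out by a basic set [V j], which plays the role of the
    neighbourhood, and by a rational [c] with [c <= lam < 2 * c]; the open set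
    [U n] collects the points of [V j] for which [V j] is still too large. The
    explicit form of the pieces makes them measurable as soon as [lam] and the
    sets [V j] are. *)
Lemma uniform_pieces (T : topologicalType) (J : countType) (V : J -> set T)
    (A : set T) (lam : T -> R) (rel : R -> T -> T -> Prop) :
  (forall p N, nbhs p N -> exists i, V i p /\ V i `<=` N) ->
  (forall p, A p -> 0 < lam p) ->
  (forall c p, A p -> c <= lam p < 2 * c ->
     \forall q \near p, A q -> rel c p q) ->
  (forall c q, A q -> open [set p | A p /\ ~ rel c p q]) ->
  exists (c : nat -> R) (i : nat -> option J) (U : nat -> set T),
    let S n := [set p | [/\ A p, c n <= lam p < 2 * c n,
        (if i n is Some j then V j p else False) & ~ U n p]] in
    [/\ forall n, 0 < c n, forall n, open (U n), A = \bigcup_n S n &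
        forall n p q, S n p -> S n q -> rel (c n) p q].
Proof.
move=> base lam0 near_rel open_rel.
pose idx n : option (J * rat) := pickle_inv n.
pose c n : R := if idx n is Some (_, a) then if 0 < a then ratr a else 1 else 1.
pose i n := if idx n is Some (j, _) then Some j else None.
pose U n := \bigcup_(q in [set q | A q /\ if i n is Some j then V j q else False])
   [set p | A p /\ ~ rel (c n) p q].
exists c, i, U => S; split.
- by move=> n; rewrite /c; case: (idx n) => // -[_ a]; case: ifP => //; rewrite ltr0q.
- by move=> n; apply: bigcup_open => q [Aq _]; exact: open_rel.
- apply/seteqP; split => [p Ap|p [n _ []]//].
  have lp := lam0 _ Ap.
  have [a /andP[a1 a2]] : exists a : rat, lam p / 2 < ratr a < lam p.
    have lt : lam p / 2 < lam p by lra.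
    by have [a] := rat_in_itvoo lt; rewrite in_itv/=; exists a.
  have a0 : 0 < a by rewrite -(@ltr0q R); lra.
  have cl : ratr a <= lam p < 2 * ratr a by apply/andP; split; lra.
  have [j [jp jN]] := base p _ (near_rel _ _ Ap cl).
  exists (pickle (j, a)); [exact: I|]; rewrite /S/= /c /i /idx pickleK_inv/= a0; split => //.
  move=> [q /= [Aq]]; rewrite /i /c /idx pickleK_inv/= a0 => jq [_]; apply.
  exact: jN jq Aq.
- move=> n p q [Ap cp ip Up] [Aq cq iq _].
  apply: contrapT => nr; apply: Up; exists q; split => //.
Qed.
End Pieces.

(** * Pointwise Lipschitz constants and increments on the line *)

Section OneD.
Context {R : realType}.
Local Notation mu := (@lebesgue_measure R).
Local Open Scope ereal_scope.

(** [lebesgue_measure] is defined on all sets as an outer measure; the image of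
    a Borel set under a continuous function need not be Borel, so the outer
    measure is what bounds images below. *)
Lemma le_lebesgue_outer : {homo mu : A B / A `<=` B >-> A <= B}.
Proof. by move=> A B AB; exact: (le_outer_measure (wlength idfun)^*%mu). Qed.

Lemma lebesgue_outer_ge0 (A : set R) : 0 <= mu A.
Proof. exact: (outer_measure_ge0 (wlength idfun)^*%mu). Qed.

Lemma lebesgue_outer_bigcup (F : (set R)^nat) :
  mu (\bigcup_n F n) <= \sum_(n <oo) mu (F n).
Proof. exact: outer_measure_sigma_subadditive. Qed.

(** Each interval of a cover of [E] meets [E] in a set whose image has diameter
    at most [L] times its length, hence lies in an interval twice as long
    centred at an image point. *)
Lemma lebesgue_lipschitz_image (E : set R) (L : R) (p : R -> R) : (0 < L)%R ->
  (forall x y, E x -> E y -> `|p y - p x| <= L * `|y - x|)%R ->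
  mu (p @` E) <= (2 * L)%:E * mu E.
Proof.
move=> L0 hp; have L20 : (0 < 2 * L)%R by lra.
rewrite muleC -lee_pdivrMr//.
apply: le_ereal_inf_tmp => _ [F cF <-].
rewrite lee_pdivrMr// muleC.
have [mF EF] := cF.
have /choice[M hM] n : exists M, p @` (E `&` F n) `<=` M /\ mu M <= (2 * L)%:E * wlength idfun (F n).
  have /ocitvP[->|[[a b /= alb ->]]] := mF n.
    by exists set0; rewrite setI0 image_set0 wlength0 mule0 measure0; split.
  have [->|/set0P[c [Ec /=]]] := eqVneq (E `&` `]a, b]) set0.
    exists set0; rewrite image_set0; split => //; rewrite measure0 mule_ge0//.
    by rewrite lee_fin ltW.
  rewrite in_itv/= => cab.
  exists [set` `[(p c - L * (b - a))%R, (p c + L * (b - a))%R]]; split.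
    move=> _ [x [Ex /=]] + <-; rewrite !in_itv/= => xab.
    have := hp _ _ Ec Ex; have : (`|x - c| <= b - a)%R by rewrite ler_norml; lra.
    move=> /(ler_wpM2l (ltW L0)) h1 h2; have := le_trans h2 h1.
    by rewrite ler_norml; lra.
  rewrite lebesgue_measure_itv (wlength_itv_bnd idfun _ _ (ltW alb))/= lte_fin.
  case: ifP => _.
    by rewrite -EFinB -EFinM lee_fin; nra.
  by rewrite -EFinM lee_fin; nra.
apply: (@le_trans _ _ (mu (\bigcup_n M n))).
  apply: le_lebesgue_outer => _ [x Ex <-].
  have [n _ Fx] := EF _ Ex; exists n => //; apply: (hM n).1.
  by exists x.
apply: le_trans (lebesgue_outer_bigcup _) _.
rewrite -nneseriesZl; last by move=> n _; exact: wlength_ge0.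
by apply: lee_nneseries => n _; [move=> _; exact: lebesgue_outer_ge0|exact: (hM n).2].
Qed.


(** [a] bounds the pointwise Lipschitz constant of [u] at [p]; for a
    differentiable function, [a] bounds the norm of the differential. *)
Definition lip_at (V : normedModType R) (u : V -> R) (p : V) (a : R) : Prop :=
  forall e, (0 < e)%R -> \forall q \near p, (`|u q - u p| <= (a + e) * `|q - p|)%R.

Lemma lip_at_continuous (V : normedModType R) (u : V -> R) (p : V) (a : R) :
  lip_at u p a -> {for p, continuous u}.
Proof.
move=> h; apply/cvgrPdist_lt => e e0.
pose k := (`|a| + 1)%R; have k0 : (0 < k)%R by rewrite ltr_wpDl.
have d0 : (0 < e / k)%R by rewrite divr_gt0.
near=> q.
rewrite distrC.
have h1 : (`|u q - u p| <= (a + 1) * `|q - p|)%R by near: q; exact: h.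
have h2 : (`|q - p| < e / k)%R.
  by rewrite distrC; near: q; apply: (@cvgr_dist_lt _ _ _ _ _ id p).
rewrite ltr_pdivlMr// in h2.
apply: le_lt_trans h1 _; apply: le_lt_trans h2; rewrite mulrC ler_wpM2l// lerD2r.
exact: ler_norm.
Unshelve. all: by end_near. Qed.

Lemma dyadic_base (x : R) N : nbhs x N -> 
  exists i : nat * int, dyadic i.1 x = i.2 /\ [set y | dyadic i.1 y = i.2] `<=` N.
Proof.
move=> /nbhs_ballP[e /= e0 eN]; have [n hn] := dyadic_near x e0.
by exists (n, dyadic n x); split => // y /= /hn; rewrite distrC => ?; exact: eN.
Qed.

(** The interval between [p a] and [p b] is covered by the images of the pieces
    of [[a, b]], and on a piece where [c <= L < 2 * c] the function is
    [2 * c]-Lipschitz. *)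
Lemma increment_le_integral_strict (p L : R -> R) a b : (a <= b)%R ->
  (forall x, 0 < L x)%R -> measurable_fun setT L -> continuous p ->
  (forall x, \forall y \near x, `|p y - p x| <= L x * `|y - x|)%R ->
  `|p b - p a|%:E <= 4%:E * \int[mu]_(x in `[a, b]) (L x)%:E.
Proof.
move=> ab L0 mL cp lip.
pose rel (c x y : R) := (`|p y - p x| <= 2 * c * `|y - x|)%R.
have [||c [i [U]]] := @uniform_pieces R R (nat * int)%type
   (fun i => [set y | dyadic i.1 y = i.2]) setT L rel (@dyadic_base) (fun x _ => L0 x).
- move=> c x _ /andP[_ h]; near=> y => _; rewrite /rel.
  have h1 : (`|p y - p x| <= L x * `|y - x|)%R by near: y; exact: lip.
  by apply: le_trans h1 _; rewrite ler_wpM2r// ltW.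
- move=> c q _; rewrite openE => x /= [_ nr].
  have {}nr : (0 < `|p q - p x| - 2 * c * `|q - x|)%R.
    by rewrite subr_gt0 ltNge; apply/negP.
  have cf : (fun y => `|p q - p y| - 2 * c * `|q - y|)%R @ x --> (`|p q - p x| - 2 * c * `|q - x|)%R.
    apply: cvgB; first by apply: cvg_norm; apply: cvgB; [exact: cvg_cst|exact: cp].
    by apply: cvgM; [exact: cvg_cst|apply: cvg_norm; apply: cvgB; [exact: cvg_cst|exact: cvg_id]].
  apply: (filterS _ (cvgr_gt _ cf _ nr)) => y /= h; split => //.
  by rewrite /rel; apply/negP; rewrite -ltNge -subr_gt0.
set S := fun n => [set x | _] => -[c0 oU SE Srel].
have mS n : measurable (S n).
  have -> : S n = ((if i n is Some j then [set y | dyadic j.1 y = j.2] else set0)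
      `&` L @^-1` [set` `[c n, (2 * c n)%R[]) `\` U n.
    apply/seteqP; split => x /=; rewrite /S/= in_itv/=; case: (i n) => [j|]; by [case|case=> -[]].
  apply: measurableD; last exact: open_measurable.
  apply: measurableI; last by rewrite -[X in measurable X]setTI; exact: mL.
  by case: (i n) => // j; rewrite dyadic_fiber; exact: measurable_itv.
pose D n := seqDU S n `&` [set` `[a, b]].
have mD n : measurable (D n).
  apply: measurableI; last exact: measurable_itv.
  by rewrite /seqDU; apply: measurableD => //; exact: bigsetU_measurable.
have DS n : D n `<=` S n by move=> x [[]].
have DE : \bigcup_n D n = [set` `[a, b]].
  by rewrite -setI_bigcupl -seqDU_bigcup_eq -SE setTI.
have tD : trivIset setT D by apply: trivIset_setIr; exact: trivIset_seqDU.
have step1 : `|p b - p a|%:E <= mu (p @` [set` `[a, b]]).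
  apply: (@le_trans _ _ (mu [set` `[Num.min (p a) (p b), Num.max (p a) (p b)]])).
    rewrite lebesgue_measure_itv/= lte_fin; case: ifP.
      rewrite -EFinB lee_fin; case: (leP (p a) (p b)) => h _.
        by rewrite ger0_norm ?subr_ge0.
      by rewrite distrC ger0_norm ?lexx// subr_ge0 ltW.
    have [->|ne] := eqVneq (p a) (p b); first by rewrite subrr normr0.
    have -> : (Num.min (p a) (p b) < Num.max (p a) (p b))%R.
      by rewrite gt_min !lt_max !ltxx; move: ne; case: (ltgtP (p a) (p b)).
    by [].
  apply: le_lebesgue_outer => v /=; rewrite in_itv/= => hv.
  have [|x xab <-] := IVT ab _ hv; last by exists x.
  by apply: continuous_subspaceT => x; exact: cp.
apply: le_trans step1 _.
rewrite -DE image_bigcup ge0_integral_bigcup//=; last 2 first.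
- by apply/measurable_EFinP; apply: measurable_funTS.
- by move=> x _; rewrite lee_fin ltW.
apply: le_trans (lebesgue_outer_bigcup _) _.
rewrite -nneseriesZl; last by move=> n _; apply: integral_ge0 => x _; rewrite lee_fin ltW.
apply: lee_nneseries => n _; first by move=> _; exact: lebesgue_outer_ge0.
apply: le_trans (@lebesgue_lipschitz_image (D n) (2 * c n) p _ _) _.
- by rewrite mulr_gt0.
- by move=> x y /DS Sx /DS Sy; exact: (Srel n).
rewrite mulrA -[(2 * 2)%R]natrM EFinM -muleA; apply: lee_wpmul2l => //.
have <- : \int[mu]_(x in D n) (c n)%:E = (c n)%:E * mu (D n).
  rewrite integral_cst. 2: exact: mD. by [].
apply: ge0_le_integral => //; first exact: mD.
- by move=> x _; rewrite lee_fin ltW.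
- by apply/measurable_EFinP; apply: measurable_funTS.
- by move=> x /DS [_ /andP[]]; rewrite lee_fin.
Unshelve. all: by end_near. Qed.

(** The strict version applied to [L + d], for every [d > 0]. *)
Lemma increment_le_integral (p L : R -> R) a b : (a <= b)%R ->
  (forall x, 0 <= L x)%R -> measurable_fun setT L ->
  (forall x, lip_at p x (L x)) ->
  `|p b - p a|%:E <= 4%:E * \int[mu]_(x in `[a, b]) (L x)%:E.
Proof.
move=> ab L0 mL lip.
have cp : continuous p by move=> x; exact: lip_at_continuous (lip x).
apply/lee_addgt0Pr => e e0.
pose d := (e / (4 * (b - a) + 1))%R.
have k0 : (0 < 4 * (b - a) + 1)%R by lra.
have d0 : (0 < d)%R by rewrite divr_gt0.
have := @increment_le_integral_strict p (fun x => L x + d)%R a b ab.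
move=> /(_ (fun x => ltr_wpDl (L0 x) d0) _ cp (fun x => lip x _ d0)).
move=> /(_ (measurable_funD mL (measurable_cst _)))/le_trans; apply.
under eq_integral do rewrite EFinD.
rewrite ge0_integralD//; last 3 first.
- by move=> x _; rewrite lee_fin.
- by apply/measurable_EFinP; apply: measurable_funTS.
- by move=> x _; rewrite lee_fin ltW.
rewrite integral_cst//= ge0_muleDr; last 2 first.
- by apply: integral_ge0 => x _; rewrite lee_fin.
- by apply: mule_ge0; [rewrite lee_fin ltW|exact: lebesgue_outer_ge0].
rewrite leeD2l// lebesgue_measure_itv/= lte_fin.
case: ifP => _; rewrite -?EFinB -!EFinM lee_fin; last by rewrite !mulr0 ltW.
have dE : (d * (4 * (b - a) + 1) = e)%R by rewrite /d divfK// gt_eqF.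
nra.
Qed.

End OneD.

(** * Measure and measurability in the plane *)

Section Dominated.
Context {R : realType}.
Local Open Scope ereal_scope.
Import HBNNSimple.

(** Comparison of the measures on subsets of [D] is enough: a simple function
    below [f] on [D] and zero elsewhere has its nonzero level sets inside
    [D]. *)
Lemma le_integral_dominated d (T : measurableType d) (m1 m2 : {measure set T -> \bar R}) (D : set T)
    (f : T -> \bar R) (c : R) :
  (0 <= c)%R -> measurable D -> measurable_fun D f -> (forall x, 0 <= f x) ->
  (forall S, measurable S -> S `<=` D -> m1 S <= c%:E * m2 S) ->
  \int[m1]_(x in D) f x <= c%:E * \int[m2]_(x in D) f x.
Proof.
move=> c0 mD mf f0 h.
rewrite -(@ge0_integral_mscale _ _ _ m2 D mD (NngNum c0) f)//.
rewrite !(ge0_integralE _ _) //; apply: ge_ereal_sup => _ [g /= gf <-].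
apply: le_ereal_sup_tmp; exists (sintegral (mscale (NngNum c0) m2) g); first by exists g.
rewrite !sintegralE lee_fsum// => r [t _ <-].
have [->|gt0] := eqVneq (g t) 0%R; first by rewrite !mul0e.
apply: lee_wpmul2l; first by rewrite lee_fin.
rewrite /mscale/=; apply: h; first exact: measurable_sfunP.
move=> x /= gx; apply: contrapT => nDx; have := gf x.
rewrite patchE memNset// lee_fin gx leNgt lt0r gt0/=.
by apply/negP/negPn; rewrite -gx.
Qed.

End Dominated.

Section CV.
Context {R : realType}.
Local Notation mu := (@lebesgue_measure R).
Local Notation mu2 := (mu \x mu)%E.
Local Notation plane := (measurableTypeR R * measurableTypeR R)%type.
Implicit Types (A B : set (R * R)) (p q : R * R).

Lemma norm_pairE (p : R * R) : `|p| = Num.max `|p.1| `|p.2|.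
Proof. by []. Qed.

Lemma measurable_fun_open A (f : R * R -> R) :
  open A -> (forall p, A p -> {for p, continuous f}) ->
  measurable_fun (A : set plane) (f : plane -> R).
Proof.
move=> oA cf; apply: (measurability _ (RGenOInfty.measurableE R)).
move=> _ [_ [a ->] <-]; apply: open_measurable_plane; rewrite openE => p [Ap /=].
rewrite in_itv/= andbT => ap; rewrite /interior/=.
near=> q; split; first by near: q; move: oA; rewrite openE => /(_ _ Ap).
rewrite /= in_itv/= andbT; near: q; exact: (cvgr_gt _ (cf _ Ap)).
Unshelve. all: by end_near. Qed.

Lemma continuous_fst_comp (T : topologicalType) (f : T -> R * R) x :
  {for x, continuous f} -> {for x, continuous (fun y => (f y).1)}.
Proof. by move=> cf; apply: continuous_comp cf _; exact: cvg_fst. Qed.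
Lemma continuous_snd_comp (T : topologicalType) (f : T -> R * R) x :
  {for x, continuous f} -> {for x, continuous (fun y => (f y).2)}.
Proof. by move=> cf; apply: continuous_comp cf _; exact: cvg_snd. Qed.

(** Both coordinates are measurable, and their preimages generate the product
    structure. *)
Lemma measurable_fun_open_pair A (f : R * R -> R * R) :
  open A -> (forall p, A p -> {for p, continuous f}) ->
  measurable_fun (A : set plane) (f : plane -> plane).
Proof.
move=> oA cf mA.
have m1 : measurable_fun (A : set plane) (fun p : plane => (f p).1).
  exact: (measurable_fun_open oA (fun p Ap => continuous_fst_comp (cf p Ap))).
have m2 : measurable_fun (A : set plane) (fun p : plane => (f p).2).
  exact: (measurable_fun_open oA (fun p Ap => continuous_snd_comp (cf p Ap))).
move: mA; apply: (measurability _ (erefl : @measurable _ plane = <<s _ >>)).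
move=> _ [_ [[Y mY <-]|[Y mY <-]] <-]; rewrite setTI.
- exact: m1 (open_measurable_plane oA) _ mY.
- exact: m2 (open_measurable_plane oA) _ mY.
Qed.

Lemma cell_base p N : nbhs p N ->
  exists i : nat * (int * int), cell i.1 i.2 p /\ cell i.1 i.2 `<=` N.
Proof.
move=> /nbhs_ballP[e /= e0 eN].
have [F [sF FE]] := open_bigcup_saturated (ball_open p e).
have : ball p e p by exact: ballxx.
rewrite {1}FE => -[n _ Fp].
exists (n, (dyadic n p.1, dyadic n p.2)); split => // q pq; apply: eN.
rewrite FE; exists n => //; apply: sF Fp; exact/esym.
Qed.

Local Open Scope ereal_scope.

Lemma plane_measure_cell n k : mu2 (cell n k) = ((2 ^- n) ^+ 2)%:E.
Proof.
rewrite cellE product_measure1E; try by rewrite dyadic_fiber; exact: measurable_itv.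
have h (j : int) : mu [set x | dyadic n x = j] = (2 ^- n)%:E.
  rewrite dyadic_fiber lebesgue_measure_itv/= lte_fin ltr_pM2r ?invr_gt0 ?exprn_gt0//.
  by rewrite ltr_int ltzD1 lexx -EFinB -mulrBl -intrB addrC addKr mul1r.
by rewrite expr2 EFinM; congr (_ * _); exact: h.
Qed.

(** A set of diameter [d] lies in the square of side [2 * d] centred at any of
    its points. *)
Lemma plane_measure_le_diam (S : set (R * R)) (d : R) : (0 <= d)%R -> measurable (S : set plane) ->
  (forall p q, S p -> S q -> `|q - p| <= d)%R -> mu2 S <= ((2 * d) ^+ 2)%:E.
Proof.
move=> d0 mS h; have [->|/set0P[a Sa]] := eqVneq S set0.
  by rewrite measure0 lee_fin sqr_ge0.
have -> : ((2 * d) ^+ 2)%:E = mu2 ([set` `[a.1 - d, a.1 + d]] `*` [set` `[a.2 - d, a.2 + d]])%R.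
  rewrite product_measure1E; try exact: measurable_itv.
  have k (x : R) : mu [set` `[x - d, x + d]%R] = (2 * d)%:E.
    rewrite lebesgue_measure_itv/= lte_fin; case: ifP.
      by rewrite -EFinB => _; congr EFin; ring.
    by move=> /negbT; rewrite -leNgt => ?; congr EFin; lra.
  by rewrite expr2 EFinM; congr (_ * _); exact/esym/k.
apply: le_measure; rewrite ?inE//; first by apply: measurableX; exact: measurable_itv.
move=> p Sp; have := h _ _ Sa Sp; rewrite norm_pairE ge_max/= => /andP[].
by rewrite !ler_distl /= !in_itv/= => -> ->.
Qed.

End CV.

(** * Change of variables up to a constant *)

Section ChangeVar.
Context {R : realType}.
Local Notation mu := (@lebesgue_measure R).
Local Notation mu2 := (mu \x mu)%E.
Local Notation plane := (measurableTypeR R * measurableTypeR R)%type.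
Local Open Scope ereal_scope.

(** The points of [S] sent into a square of side [l] are at mutual distance at
    most [l / c]; this compares the two measures on dyadic squares. *)
Lemma expansive_preimage_le (S : set plane) (Phi : plane -> plane) (c : R) :
  (0 < c)%R -> measurable S -> measurable_fun setT Phi ->
  (forall p q, S p -> S q -> c * `|q - p| <= `|Phi q - Phi p|)%R ->
  forall E, measurable E -> mu2 (Phi @^-1` E `&` S) <= (4 / c ^+ 2)%:E * mu2 E.
Proof.
move=> c0 mS mPhi hS E mE.
have k0 : (0 <= 4 / c ^+ 2)%R by rewrite divr_ge0// sqr_ge0.
pose rho : {measure set plane -> \bar R} :=
  measure_function_pushforward__canonical__measure_function_Measure (mrestr mu2 mS) mPhi.
rewrite -[X in X <= _]/(rho E).
apply: (le_measure_cells (mu := (mu \x mu)%E) k0) => // [n k|k];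
  last by rewrite [X in X < _]plane_measure_cell ltry.
rewrite -[X in X <= _]/(mu2 (Phi @^-1` cell n k `&` S)).
have n0 : (0 < 2 ^- n :> R)%R by rewrite invr_gt0 exprn_gt0.
rewrite [X in _ <= _ * X]plane_measure_cell -EFinM.
have mPC : measurable (Phi @^-1` cell n k).
  by rewrite -[X in measurable X]setTI; exact: (mPhi measurableT _ (measurable_cell n k)).
apply: le_trans (@plane_measure_le_diam _ _ (c^-1 * 2 ^- n)%R _ _ _) _.
- by rewrite mulr_ge0// ltW// invr_gt0.
- exact: measurableI.
- move=> p q [/= Pp Sp] [/= Pq Sq]; have := hS _ _ Sp Sq.
  have : (`|Phi q - Phi p| <= 2 ^- n)%R.
    move: Pp Pq; rewrite /cell/= => <- [e1 e2].
    have dd (x y : R) : dyadic n y = dyadic n x -> (`|y - x| <= 2 ^- n)%R.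
      move=> e; have Hx : [set z | dyadic n z = dyadic n x] x by [].
      have Hy : [set z | dyadic n z = dyadic n x] y by [].
      move: Hx Hy; rewrite dyadic_fiber/= !in_itv/= intrD mulrDl mul1r => /andP[? ?] /andP[? ?].
      by rewrite ler_norml; apply/andP; split; lra.
    by rewrite norm_pairE ge_max; apply/andP; split; apply: dd.
  by rewrite ler_pdivlMl// => h1 h2; exact: le_trans h2 h1.

- by rewrite lee_fin -[(c ^+ 2)^-1%R]exprVn le_eqVlt; apply/orP; left; apply/eqP; ring.
Qed.

(** On a piece with [c <= lam < 2 * c] the weight [lam ^ 2] is at most
    [4 * c ^ 2], while [Phi] expands distances by at least [c / 4] and so sends
    the piece to a set of at least [c ^ 2 / 64] times its measure: the factor
    [256] is [4 * 64]. The images of disjoint pieces are disjoint because [Phi]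
    is injective. *)
Lemma change_of_variables_le (A B : set plane) (Phi Psi : plane -> plane) (p0 : plane)
    (lam : plane -> R) (F : plane -> \bar R) :
  open A -> open B -> ~ B p0 ->
  (forall p, A p -> B (Phi p) /\ Psi (Phi p) = p) ->
  (forall q, B q -> A (Psi q) /\ Phi (Psi q) = q) ->
  (forall p, A p -> {for p, continuous Phi}) ->
  (forall q, B q -> {for q, continuous Psi}) ->
  measurable_fun A lam -> (forall p, A p -> 0 < lam p)%R ->
  (forall p, A p -> \forall q \near p, lam p * `|q - p| <= 4 * `|Phi q - Phi p|)%R ->
  measurable_fun B F -> (forall q, 0 <= F q) ->
  \int[mu2]_(p in A) (F (Phi p) * (lam p ^+ 2)%:E) <= 256%:E * \int[mu2]_(q in B) F q.
Proof.
move=> oA oB nBp0 AB BA cPhi cPsi mlam lam0 lip mF F0.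
have mA : measurable (A : set plane) := open_measurable_plane oA.
have mB : measurable (B : set plane) := open_measurable_plane oB.
have mPhiA : measurable_fun (A : set plane) (Phi : plane -> plane) := measurable_fun_open_pair oA cPhi.
have mPsiB : measurable_fun (B : set plane) (Psi : plane -> plane) := measurable_fun_open_pair oB cPsi.
pose rel (c : R) (p q : plane) := (c * `|q - p| <= 4 * `|Phi q - Phi p|)%R.
have [||c [i [U]]] := @uniform_pieces R plane (nat * (int * int))%type
   (fun i => cell i.1 i.2) A lam rel (@cell_base R) lam0.
- move=> c p Ap /andP[h _]; near=> q => _; rewrite /rel.
  have h1 : (lam p * `|q - p| <= 4 * `|Phi q - Phi p|)%R by near: q; exact: lip.
  by apply: le_trans h1; rewrite ler_wpM2r.
- move=> c q Aq; rewrite openE => p /= [Ap nr]; rewrite /interior/=.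
  have {}nr : (0 < c * `|q - p| - 4 * `|Phi q - Phi p|)%R.
    by rewrite subr_gt0 ltNge; apply/negP.
  have cf : (fun y => c * `|q - y| - 4 * `|Phi q - Phi y|)%R @ p -->
      (c * `|q - p| - 4 * `|Phi q - Phi p|)%R.
    apply: cvgB; apply: cvgM; try exact: cvg_cst; apply: cvg_norm; apply: cvgB; try exact: cvg_cst.
      exact: cvg_id.
    exact: cPhi.
  near=> y; split; first by near: y; move: oA; rewrite openE => /(_ _ Ap).
  apply/negP; rewrite -ltNge -subr_gt0; near: y; exact: (cvgr_gt _ cf _ nr).
set S := fun n => [set x | _] => -[c0 oU SE Srel].
have mS n : measurable (S n : set plane).
  have -> : S n = ((if i n is Some j then cell j.1 j.2 else set0)
      `&` (A `&` lam @^-1` [set` `[c n, (2 * c n)%R[])) `\` U n.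
    by apply/seteqP; split => x /=; rewrite /S/= in_itv/=; case: (i n) => [j|];
      by [case|case=> -[] ? []].
  apply: measurableD; last exact: open_measurable_plane.
  apply: measurableI; last by apply: mlam.
  by case: (i n) => // j; exact: measurable_cell.
pose D n := seqDU S n.
have mD n : measurable (D n : set plane).
  by rewrite /D /seqDU; apply: measurableD => //; exact: bigsetU_measurable.
have DS n : D n `<=` S n by move=> x [].
have DA n : D n `<=` A by move=> x /DS[].
have DE : A = \bigcup_n D n by rewrite -seqDU_bigcup_eq.
have tD : trivIset setT D by exact: trivIset_seqDU.
(* [P] agrees with [Phi] on [A] and is measurable everywhere; the value [p0]
   lies outside [B], so the preimage of a subset of [B] stays in [A]. *)
pose P p := if p \in A then Phi p else p0.
have PA p : A p -> P p = Phi p by move=> Ap; rewrite /P mem_set.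
have mP : measurable_fun setT P.
  apply: measurable_fun_if => //.
    apply: (measurable_fun_bool true); rewrite setTI.
    by rewrite (_ : _ @^-1` _ = A)//; apply/seteqP; split => x /=; [exact: set_mem|exact: mem_set].
  by rewrite setTI (_ : _ @^-1` _ = A)//; apply/seteqP; split => x /=; [exact: set_mem|exact: mem_set].
pose T n := B `&` Psi @^-1` D n.
have mT n : measurable (T n) by apply: mPsiB.
have PT n : P @^-1` T n = D n.
  apply/seteqP; split => p /=.
    rewrite /P; case: ifP => [/set_mem Ap [Bp /=]|_ []//].
    by rewrite (AB p Ap).2.
  move=> Dp; have Ap := DA _ _ Dp; rewrite PA//; split; first exact: (AB p Ap).1.
  by rewrite /= (AB p Ap).2.
have tT : trivIset setT T.
  apply/trivIsetP => k l _ _ kl; apply/seteqP; split => // q [[_ h1] [_ h2]].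
  move/trivIsetP : tD => /(_ k l I I kl) e.
  have hh : (D k `&` D l) (Psi q) by split.
  by move: hh; rewrite e.
have key n : \int[mu2]_(p in D n) (F (Phi p) * (lam p ^+ 2)%:E) <= 256%:E * \int[mu2]_(q in T n) F q.
  have FD : measurable_fun (D n) (F \o Phi).
    apply: (measurable_comp mB _ mF).
      by move=> _ [p Dp <-]; exact: (AB p (DA _ _ Dp)).1.
    exact: measurable_funS mPhiA.
  apply: (@le_trans _ _ (\int[mu2]_(p in D n) ((4 * c n ^+ 2)%:E * F (P p)))).
    apply: ge0_le_integral => //.
    - by move=> p _; rewrite mule_ge0// lee_fin sqr_ge0.
    - apply: emeasurable_funM => //; apply/measurable_EFinP; apply: measurable_funX.
      exact: measurable_funS mlam.
    - apply: emeasurable_funM => //; apply: eq_measurable_fun FD => p; rewrite inE => Dp /=.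
      by rewrite PA//; exact: DA Dp.
    - move=> p Dp; have [Ap /andP[l1 l2] _ _] := DS _ _ Dp.
      rewrite PA// muleC; apply: lee_wpmul2r => //; rewrite lee_fin.
      by have := c0 n; nra.
  have FP : measurable_fun (D n) (F \o P).
    by apply: eq_measurable_fun FD => p; rewrite inE => Dp /=; rewrite PA//; exact: DA Dp.
  have c2 : (0 < c n ^+ 2)%R by rewrite exprn_gt0.
  rewrite ge0_integralZl//; last by rewrite lee_fin mulr_ge0// ltW.
  have FT : measurable_fun (T n) F by apply: measurable_funS mF => // q [].
  pose nu : {measure set plane -> \bar R} :=
    measure_function_pushforward__canonical__measure_function_Measure mu2 mP.
  have -> : \int[mu2]_(p in D n) F (P p) = \int[nu]_(q in T n) F q.
    by rewrite ge0_integral_pushforward// PT.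
  have h64 : (0 <= 64 / c n ^+ 2)%R by rewrite divr_ge0// ltW.
  have h : forall E, measurable E -> E `<=` T n -> mu2 (P @^-1` E) <= (64 / c n ^+ 2)%:E * mu2 E.
    move=> E mE ET.
    have -> : P @^-1` E = P @^-1` E `&` D n.
      by apply/esym/setIidPl; rewrite -PT => p /= /ET.
    have -> : (64 / c n ^+ 2 = 4 / (c n / 4) ^+ 2)%R.
      by field; rewrite gt_eqF.
    apply: expansive_preimage_le => //; first by rewrite divr_gt0.
    move=> p q Dp Dq; rewrite !PA; try by [exact: DA Dp|exact: DA Dq].
    by have := Srel n _ _ (DS _ _ Dp) (DS _ _ Dq); rewrite /rel; lra.
  have dom := le_integral_dominated (m1 := nu) (m2 := (mu \x mu)) h64 (mT n) FT F0 h.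
  apply: le_trans (lee_wpmul2l _ dom) _; first by rewrite lee_fin mulr_ge0// ltW.
  rewrite muleA -EFinM; apply: lee_wpmul2r; first by apply: integral_ge0.
  by rewrite lee_fin (_ : _ * _ = 256)%R//; field; rewrite gt_eqF.
have BT : \bigcup_n T n = B.
  rewrite -setI_bigcupr -preimage_bigcup -DE; apply/setIidPl => q Bq; exact: (BA q Bq).1.
rewrite DE ge0_integral_bigcup//=; last 2 first.
- rewrite -DE; apply: emeasurable_funM.
    by apply: (measurable_comp mB _ mF mPhiA) => _ [p Ap <-]; exact: (AB p Ap).1.
  by apply/measurable_EFinP; apply: measurable_funX.
- by move=> p _; rewrite mule_ge0// lee_fin sqr_ge0.
rewrite -BT ge0_integral_bigcup//=; last by rewrite BT.
rewrite -nneseriesZl; last by move=> n _; exact: integral_ge0.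
apply: lee_nneseries => n _; last exact: key.
by move=> _; apply: integral_ge0 => p _; rewrite mule_ge0// lee_fin sqr_ge0.
Unshelve. all: by end_near. Qed.

End ChangeVar.

(** * Sobolev inequality in the unit box *)

Section LipAt.
Context {R : realType} {V : normedModType R}.
Implicit Types (u v : V -> R) (p : V).

Lemma lip_at_mul u v p a b : 0 <= a -> 0 <= b -> lip_at u p a -> lip_at v p b ->
  lip_at (fun q => u q * v q) p (`|u p| * b + `|v p| * a).
Proof.
move=> a0 b0 lu lv e e0.
pose k := `|u p| + b + `|v p| + 1.
have k0 : 0 < k by rewrite /k; have := normr_ge0 (u p); have := normr_ge0 (v p); lra.
(* [d] is the common error for both factors and for [|u q|]; the expansion
   exceeds the claim by [d * (|u p| + b + |v p| + d)], at most [d * k]. *)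
pose d := Num.min 1 (e / k).
have d0 : 0 < d by rewrite lt_min ltr01 divr_gt0.
have d1 : d <= 1 by rewrite ge_min lexx.
have dk : d * k <= e by rewrite -ler_pdivlMr// ge_min lexx orbT.
near=> q.
have h1 : `|u q - u p| <= (a + d) * `|q - p| by near: q; exact: lu.
have h2 : `|v q - v p| <= (b + d) * `|q - p| by near: q; exact: lv.
have h3 : `|u q - u p| < d.
  by rewrite distrC; near: q; have := lip_at_continuous lu => /cvgrPdist_lt /(_ _ d0).
have h4 : `|u q| <= `|u p| + d.
  by rewrite -[u q](subrK (u p)) addrC; apply: le_trans (ler_normD _ _) _; rewrite lerD2l ltW.
rewrite (_ : u q * v q - u p * v p = u q * (v q - v p) + v p * (u q - u p)); last by ring.
apply: le_trans (ler_normD _ _) _; rewrite !normrM.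
apply: (@le_trans _ _ (((`|u p| + d) * (b + d) + `|v p| * (a + d)) * `|q - p|)).
  rewrite mulrDl -!mulrA; apply: lerD; first by apply: ler_pM.
  by apply: ler_wpM2l.
apply: ler_wpM2r => //; rewrite /k in dk.
have : d * d <= d by rewrite -[leRHS]mulr1 ler_wpM2l// ltW.
nra.
Unshelve. all: by end_near. Qed.

(** Leibniz rule by induction; at [m = 0] the factor [m%:R] vanishes, whatever
    the truncated exponent [m.-1] is. *)
Lemma lip_at_exp u p a m : 0 <= a -> lip_at u p a ->
  lip_at (fun q => u q ^+ m) p (m%:R * `|u p| ^+ m.-1 * a).
Proof.
move=> a0 lu; elim: m => [|m ih].
  move=> e e0; apply: nearW => q; rewrite !expr0 subrr normr0.
  by rewrite !mul0r add0r mulr_ge0// ltW.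
have := lip_at_mul a0 _ lu ih; rewrite !mulr_ge0 ?exprn_ge0// => /(_ isT).
have -> : `|u p| * (m%:R * `|u p| ^+ m.-1 * a) + `|u p ^+ m| * a = m.+1%:R * `|u p| ^+ m.+1.-1 * a.
  by rewrite normrX /= -addn1 natrD; case: m {ih} => [|m] /=; rewrite ?exprS ?expr0; ring.
by under [X in lip_at X]eq_fun do rewrite -exprS.
Qed.

End LipAt.

Section Sobolev.
Context {R : realType}.
Local Notation mu := (@lebesgue_measure R).
Local Notation mu2 := (mu \x mu)%E.
Local Notation plane := (measurableTypeR R * measurableTypeR R)%type.

Lemma lip_at_slice1 (u : R * R -> R) x y a :
  lip_at u (x, y) a -> lip_at (fun t => u (t, y)) x a.
Proof.
move=> lu e e0; have h := lu _ e0.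
have cv : (t, y) @[t --> x] --> (x, y) by exact: (cvg_pair (@cvg_id _ (nbhs x)) (cvg_cst y)).
have {}h : \forall t \near x, `|u (t, y) - u (x, y)| <= (a + e) * `|(t, y) - (x, y)| := cv _ h.
apply: (filterS _ h) => t /=; rewrite norm_pairE/= subrr normr0.
by rewrite (max_idPl _).
Qed.

Lemma lip_at_slice2 (u : R * R -> R) x y a :
  lip_at u (x, y) a -> lip_at (fun t => u (x, t)) y a.
Proof.
move=> lu e e0; have h := lu _ e0.
have cv : (x, t) @[t --> y] --> (x, y) by exact: (cvg_pair (cvg_cst x) (@cvg_id _ (nbhs y))).
have {}h : \forall t \near y, `|u (x, t) - u (x, y)| <= (a + e) * `|(x, t) - (x, y)| := cv _ h.
apply: (filterS _ h) => t /=; rewrite norm_pairE/= subrr normr0.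
by rewrite (max_idPr _).
Qed.

Local Open Scope ereal_scope.

(** Start from the point [-2], where [p] vanishes. *)
Lemma norm_le_integral (p L : R -> R) :
  (forall x, 0 <= L x)%R -> measurable_fun setT L ->
  (forall x, lip_at p x (L x)) -> (forall x, 1 < `|x| -> p x = 0)%R ->
  forall x, `|p x|%:E <= 4%:E * \int[mu]_t (L t)%:E.
Proof.
move=> L0 mL lip p0 x.
have [x2|x2] := ltP x (-2)%R.
  rewrite p0; last by rewrite ltr0_norm; lra.
  by rewrite normr0 mule_ge0//; apply: integral_ge0 => t _; rewrite lee_fin.
have := increment_le_integral x2 L0 mL lip.
rewrite (p0 (-2)%R) ?subr0; last by rewrite normrN ger0_norm; lra.
move=> /le_trans; apply; apply: lee_wpmul2l => //.
apply: ge0_subset_integral => //.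
- by apply/measurable_EFinP.
- by move=> t _; rewrite lee_fin.
Qed.

Lemma measurable_lip (u : plane -> R) (L : plane -> R) :
  (forall p, lip_at (u : R * R -> R) p (L p)) -> measurable_fun setT u.
Proof.
move=> lip; apply: (@measurable_fun_open R setT) => [|p _]; first exact: openT.
exact: lip_at_continuous (lip p).
Qed.

(** [|u (x, y)|] is at most [4 * a y] and at most [4 * b x], the integrals of
    [L] along the horizontal and the vertical line, and the integral of
    [a y * b x] is the square of the integral of [L]. *)
Lemma gagliardo_nirenberg (u L : plane -> R) :
  (forall p, 0 <= L p)%R -> measurable_fun setT L ->
  (forall p : R * R, lip_at (u : R * R -> R) p (L p)) ->
  (forall p : R * R, 1 < `|p| -> u p = 0)%R ->
  \int[mu2]_p (u p ^+ 2)%:E <= 16%:E * (\int[mu2]_p (L p)%:E * \int[mu2]_p (L p)%:E).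
Proof.
move=> L0 mL lip u0.
have mu_ := measurable_lip lip.
pose a y := \int[mu]_x (L (x, y))%:E.
pose b x := \int[mu]_y (L (x, y))%:E.
have mLE : measurable_fun setT (fun p : plane => (L p)%:E) by exact/measurable_EFinP.
have L0E (p : plane) : 0 <= (L p)%:E by rewrite lee_fin.
have mb : measurable_fun setT b.
  exact: (@measurable_fun_fubini_tonelli_F _ _ _ _ _ mu _ mLE L0E).
have ma : measurable_fun setT a.
  exact: (@measurable_fun_fubini_tonelli_G _ _ _ _ _ mu _ mLE L0E).
have a0 y : 0 <= a y by apply: integral_ge0.
have b0 x : 0 <= b x by apply: integral_ge0.
have ua x y : `|u (x, y)|%:E <= 4%:E * a y.
  apply: (@norm_le_integral (fun t => u (t, y)) (fun t => L (t, y))) => //.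
  - exact: measurableT_comp.
  - by move=> t; exact: lip_at_slice1.
  - by move=> t t1; apply: u0; rewrite norm_pairE lt_max t1.
have ub x y : `|u (x, y)|%:E <= 4%:E * b x.
  apply: (@norm_le_integral (fun t => u (x, t)) (fun t => L (x, t))) => //.
  - exact: measurableT_comp.
  - by move=> t; exact: lip_at_slice2.
  - by move=> t t1; apply: u0; rewrite norm_pairE lt_max t1 orbT.
have aI : \int[mu2]_p (L p)%:E = \int[mu]_y a y by rewrite (fubini_tonelli2 _ mLE L0E).
have bI : \int[mu2]_p (L p)%:E = \int[mu]_x b x by rewrite (fubini_tonelli1 _ mLE L0E).
rewrite {1}bI aI.
have mu2u : measurable_fun setT (fun p : plane => (u p ^+ 2)%:E).
  by apply/measurable_EFinP; apply: measurable_funX.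
rewrite fubini_tonelli1//; last by move=> p; rewrite lee_fin sqr_ge0.
apply: (@le_trans _ _ (\int[mu]_x (16%:E * b x * \int[mu]_y a y))).
  apply: ge0_le_integral => //.
  - by move=> x _; apply: integral_ge0 => y _; rewrite lee_fin sqr_ge0.
  - apply: (@measurable_fun_fubini_tonelli_F _ _ _ _ _ mu _ mu2u).
    by move=> p; rewrite lee_fin sqr_ge0.
  - apply: emeasurable_funM => //; exact: emeasurable_funM.
  - move=> x _; rewrite -ge0_integralZl//; last by rewrite mule_ge0.
    apply: ge0_le_integral => //.
    + by move=> y _; rewrite lee_fin sqr_ge0.
    + exact: (measurableT_comp mu2u (pair1_measurable x)).
    + exact: emeasurable_funM.
    + move=> y _; rewrite -real_normK ?num_real// expr2 EFinM.
      apply: le_trans (lee_pmul _ _ (ub x y) (ua x y)) _; rewrite ?lee_fin//.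
      by rewrite muleACA -EFinM -natrM muleA.
rewrite ge0_integralZr//; last 3 first.
- exact: emeasurable_funM.
- by move=> x _; rewrite mule_ge0.
- exact: integral_ge0.
by rewrite ge0_integralZl// muleA.
Qed.


Definition box : set plane := [set p : R * R | (`|p| <= 1)%R].

Lemma boxE : box = [set` `[(-1)%R, 1%R]] `*` [set` `[(-1)%R, 1%R]].
Proof.
apply/seteqP; split => -[x y]; rewrite /box/= norm_pairE/= !in_itv/= ge_max !ler_norml.
  by move=> /andP[-> ->].
by move=> [-> ->].
Qed.

Lemma measurable_box : measurable box.
Proof. by rewrite boxE; apply: measurableX; exact: measurable_itv. Qed.

Lemma plane_measure_box : mu2 box = 4%:E.
Proof.
rewrite boxE product_measure1E; try exact: measurable_itv.
have h : mu [set` `[(-1)%R, 1%R]] = 2%:E.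
  rewrite lebesgue_measure_itv/= lte_fin ifT; last lra.
  by rewrite -EFinB; congr EFin; lra.
by transitivity (2%:E * 2%:E : \bar R); [congr (_ * _)|rewrite -EFinM -natrM].
Qed.

(** [G] is an upper bound for the gradient of [g], normalized in [L^2]; both
    functions live in the unit box, the unit ball of the maximum norm. *)
Definition sobolev_pair (g G : plane -> R) :=
  [/\ forall p, (0 <= G p)%R, measurable_fun setT G,
      forall p : R * R, lip_at (g : R * R -> R) p (G p),
      forall p : R * R, (1 < `|p|)%R -> g p = 0%R /\ G p = 0%R &
      \int[mu2]_p (G p ^+ 2)%:E <= 1].

(** [gagliardo_nirenberg] for [u = g ^ m.+1], whose pointwise Lipschitz constant
    is at most [m.+1 * |g| ^ m * G], hence at most
    [m.+1 / 2 * (g ^ (2 * m) + G ^ 2)]. *)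
Lemma even_power_bound m : exists2 K : R, (0 <= K)%R & forall g G, sobolev_pair g G ->
  \int[mu2]_(p in box) (g p ^+ (2 * m))%:E <= K%:E.
Proof.
elim: m => [|m [K K0 ih]].
  exists 4%R => // g G _.
  have -> : \int[mu2]_(p in box) (g p ^+ (2 * 0))%:E = \int[mu2]_(p in box) 1.
    by apply: eq_integral => p _; rewrite muln0 expr0.
  rewrite integral_cst; last exact: measurable_box.
  by rewrite mul1e [leLHS]plane_measure_box.
(* [C] bounds the integral of the pointwise Lipschitz constant. *)
pose C := (m.+1%:R / 2 * (K + 1) : R)%R.
have C0 : (0 <= C)%R by rewrite mulr_ge0 ?divr_ge0 ?addr_ge0.
exists (16 * (C * C))%R => [|g G [G0 mG lip off G1]]; first by rewrite mulr_ge0// mulr_ge0.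
have mg := measurable_lip lip.
have even_ge0 (x : R) k : (0 <= x ^+ (2 * k))%R by rewrite exprM exprn_ge0// sqr_ge0.
pose L p := (m.+1%:R * `|g p| ^+ m * G p)%R.
have L0 p : (0 <= L p)%R by rewrite !mulr_ge0 ?exprn_ge0.
have mL : measurable_fun setT L.
  apply: measurable_funM => //; apply: measurable_funM => //.
  by apply: measurable_funX; exact: measurableT_comp.
have mGE : measurable_fun setT (fun p => (G p ^+ 2)%:E).
  by apply/measurable_EFinP; apply: measurable_funX.
have mbox := measurable_box.
have LC : \int[mu2]_p (L p)%:E <= C%:E.
  have -> : \int[mu2]_p (L p)%:E = \int[mu2]_(p in box) (L p)%:E.
    rewrite [RHS]integral_mkcond; apply: eq_integral => p _; rewrite patchE.
    case: ifPn => // /negP np; rewrite /L (off p _).2 ?mulr0//.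
    by rewrite ltNge; apply/negP => h; apply: np; rewrite inE.
  apply: (@le_trans _ _ (\int[mu2]_(p in box)
      ((m.+1%:R / 2)%:E * ((g p ^+ (2 * m))%:E + (G p ^+ 2)%:E)))).
    apply: ge0_le_integral => //.
    - by move=> p _; rewrite lee_fin.
    - by apply/measurable_EFinP; exact: measurable_funTS.
    - apply: measurable_funTS; apply: emeasurable_funM => //; apply: emeasurable_funD => //.
      by apply/measurable_EFinP; apply: measurable_funX.
    - move=> p _; rewrite -EFinD -EFinM lee_fin /L -!mulrA ler_wpM2l//.
      rewrite mulrC exprM -real_normK ?num_real// -exprM mulnC exprM.
      have := sqr_ge0 (`|g p| ^+ m - G p)%R; nra.
  rewrite ge0_integralZl//; last 2 first.
  - apply: measurable_funTS; apply: emeasurable_funD => //.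
    by apply/measurable_EFinP; apply: measurable_funX.
  - by move=> p _; rewrite adde_ge0// lee_fin ?sqr_ge0.
  rewrite ge0_integralD//; last 4 first.
  - by move=> p _; rewrite lee_fin.
  - by apply: measurable_funTS; apply/measurable_EFinP; apply: measurable_funX.
  - by move=> p _; rewrite lee_fin sqr_ge0.
  - exact: measurable_funTS.
  rewrite /C [in leRHS]EFinM [in leRHS]EFinD; apply: lee_wpmul2l; first by rewrite lee_fin divr_ge0.
  apply: leeD; first exact: ih (And5 G0 mG lip off G1).
  apply: le_trans G1; apply: ge0_subset_integral => //.
  by move=> p _; rewrite lee_fin sqr_ge0.
have lipm (p : R * R) : lip_at (fun q : R * R => g q ^+ m.+1)%R p (L p) by exact: lip_at_exp.
have := @gagliardo_nirenberg (fun p => g p ^+ m.+1)%R L L0 mL lipm.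
move=> /(_ _) GN.
apply: (@le_trans _ _ (\int[mu2]_p ((g p ^+ m.+1) ^+ 2)%:E)).
  under eq_integral do rewrite mulnC exprM.
  apply: ge0_subset_integral => //.
    by apply/measurable_EFinP; do 2 apply: measurable_funX.
  by move=> p _; rewrite lee_fin sqr_ge0.
apply: le_trans (GN _) _.
  by move=> p /off[-> _]; rewrite expr0n.
rewrite !EFinM; apply: lee_wpmul2l => //.
have I0 : 0 <= \int[mu2]_p (L p)%:E by apply: integral_ge0 => p _; rewrite lee_fin.
exact: lee_pmul.
Qed.

Lemma powR_le_even (r : R) m (t : R) : (0 <= r)%R -> (r <= (2 * m)%:R)%R ->
  (`|t| `^ r <= 1 + t ^+ (2 * m))%R.
Proof.
move=> r0 rm.
have e : (t ^+ (2 * m) = `|t| ^+ (2 * m))%R by rewrite !exprM real_normK ?num_real.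
rewrite e; have [t1|/ltW t1] := leP `|t|%R 1%R.
  have h : (`|t| `^ r <= 1 `^ r)%R by apply: ge0_ler_powR; rewrite ?nnegrE.
  by apply: le_trans h _; rewrite powR1 lerDl exprn_ge0.
by rewrite -powR_mulrn// (@le_trans _ _ (`|t| `^ (2 * m)%:R)%R) ?lerDr//; apply: ler_powR.
Qed.

Lemma power_bound (r : R) : (0 <= r)%R -> exists2 K : R, (0 < K)%R & forall g G, sobolev_pair g G ->
  \int[mu2]_(p in box) (`|g p| `^ r)%:E <= K%:E.
Proof.
move=> r0; pose m := Num.bound r.
have rm : (r <= (2 * m)%:R)%R.
  rewrite natrM; have := archi_boundP r0; rewrite -/m => h; have : (0 <= m%:R :> R)%R by []; lra.
have [K K0 hK] := even_power_bound m.
exists (4 + K)%R; first by lra.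
move=> g G gG; have [G0 mG lip off G1] := gG.
have mg := measurable_lip lip.
have mbox := measurable_box.
have even_ge0 (x : R) k : (0 <= x ^+ (2 * k))%R by rewrite exprM exprn_ge0// sqr_ge0.
apply: (@le_trans _ _ (\int[mu2]_(p in box) (1 + (g p ^+ (2 * m))%:E))).
  apply: ge0_le_integral => //.
  - apply: measurable_funTS; apply/measurable_EFinP.
    have h1 : measurable_fun setT (fun p : plane => `|g p|%R) by exact: measurableT_comp.
    exact: (measurableT_comp (measurable_powR r) h1).
  - by apply: emeasurable_funD => //; apply: measurable_funTS;
      apply/measurable_EFinP; apply: measurable_funX.
  - by move=> p _; rewrite -EFinD lee_fin; exact: powR_le_even.
rewrite ge0_integralD//; last 2 first.
- by move=> p _; rewrite lee_fin.
- by apply: measurable_funTS; apply/measurable_EFinP; apply: measurable_funX.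
rewrite EFinD; apply: leeD; last exact: hK gG.
by rewrite integral_cst ?mul1e ?[leLHS]plane_measure_box.
Qed.

End Sobolev.

(** * Maps with a pointwise dilation *)

Section Transfer.
Context {R : realType}.
Local Notation mu := (@lebesgue_measure R).
Local Notation mu2 := (mu \x mu)%E.
Local Notation plane := (measurableTypeR R * measurableTypeR R)%type.

(** A homeomorphism from [A] onto [B] that dilates distances near [p] by about
    [lam p]. The factor [4] leaves room for passing from the Euclidean norm to
    the maximum norm of [R * R] and for the error term of the derivative. *)
Record quasi_conformal_chart (A B : set (R * R)) (Phi Psi : R * R -> R * R)
    (lam : R * R -> R) : Prop := {
  chart_openA : open A;
  chart_openB : open B;
  chart_Phi : forall p, A p -> B (Phi p) /\ Psi (Phi p) = p;
  chart_Psi : forall q, B q -> A (Psi q) /\ Phi (Psi q) = q;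
  chart_contPhi : forall p, A p -> {for p, continuous Phi};
  chart_contPsi : forall q, B q -> {for q, continuous Psi};
  chart_meas : measurable_fun (A : set plane) (lam : plane -> R);
  chart_gt0 : forall p, A p -> 0 < lam p;
  chart_lower : forall p, A p -> \forall q \near p,
    lam p * `|q - p| <= 4 * `|Phi q - Phi p|;
  chart_upper : forall p, A p -> \forall q \near p,
    `|Phi q - Phi p| <= 4 * lam p * `|q - p| }.

(** Charts are stable under inversion, so the change of variables applies in
    both directions: to [Phi] for the powers of the function, to [Psi] for the
    Dirichlet integral. *)
Lemma chart_inv A B Phi Psi lam : quasi_conformal_chart A B Phi Psi lam ->
  quasi_conformal_chart B A Psi Phi (fun q => (lam (Psi q))^-1).
Proof.
move=> [oA oB hPhi hPsi cPhi cPsi mlam lam0 low up].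
have near_Psi q (P : R * R -> Prop) : B q -> (\forall p \near Psi q, P p) ->
    \forall q' \near q, B q' /\ P (Psi q').
  move=> Bq hP; near=> q'; split.
    by near: q'; move: oB; rewrite openE => /(_ _ Bq).
  by near: q'; exact: (cPsi _ Bq _ hP).
split => //.
- have m1 : measurable_fun (B : set plane) (lam \o Psi : plane -> R).
    have mPsi : measurable_fun (B : set plane) (Psi : plane -> plane) :=
      measurable_fun_open_pair oB cPsi.
    have mA : measurable (A : set plane) := open_measurable_plane oA.
    by apply: (measurable_comp mA _ mlam mPsi) => _ [q Bq <-]; exact: (hPsi q Bq).1.
  have m2 : measurable_fun (B : set plane) (fun q : plane => (lam (Psi q)) `^ (-1)).
    exact: (measurableT_comp (measurable_powR (-1)) m1).
  apply: eq_measurable_fun m2 => q /set_mem Bq; rewrite powR_inv1// ltW//.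
  by apply: lam0; exact: (hPsi q Bq).1.
- by move=> q Bq; rewrite invr_gt0; apply: lam0; exact: (hPsi q Bq).1.
- move=> q Bq; have [Ap e] := hPsi q Bq.
  apply: (filterS _ (near_Psi q _ Bq (up _ Ap))) => q' [Bq'].
  have l0 := lam0 _ Ap; rewrite (hPsi _ Bq').2 e => h.
  by rewrite ler_pdivrMl//; apply: le_trans h _; rewrite mulrCA mulrA.
- move=> q Bq; have [Ap e] := hPsi q Bq.
  apply: (filterS _ (near_Psi q _ Bq (low _ Ap))) => q' [Bq'].
  have l0 := lam0 _ Ap; rewrite (hPsi _ Bq').2 e => h.
  by rewrite [4 * _]mulrC -mulrA ler_pdivlMl.
Unshelve. all: by end_near. Qed.

Local Open Scope ereal_scope.

Lemma chart_integral_le A B Phi Psi lam (F : plane -> \bar R) :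
  quasi_conformal_chart A B Phi Psi lam -> (exists p0, ~ B p0) ->
  measurable_fun (B : set plane) F -> (forall q, 0 <= F q) ->
  \int[mu2]_(p in A) (F (Phi p) * (lam p ^+ 2)%:E) <= 256%:E * \int[mu2]_(q in B) F q.
Proof.
move=> [oA oB hPhi hPsi cPhi cPsi mlam lam0 low up] [p0 Bp0] mF F0.
by apply: (@change_of_variables_le R A B Phi Psi p0).
Qed.

Lemma sobolev_pair_scale g G (s : R) : (0 < s)%R ->
  (forall p, 0 <= G p)%R -> measurable_fun setT (G : plane -> R) ->
  (forall p : R * R, lip_at (g : R * R -> R) p (G p)) ->
  (forall p : R * R, (1 < `|p|)%R -> g p = 0%R /\ G p = 0%R) ->
  \int[mu2]_p (G p ^+ 2)%:E <= (s ^+ 2)%:E ->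
  sobolev_pair (fun p => g p / s)%R (fun p => G p / s)%R.
Proof.
move=> s0 G0 mG lip off GI; split.
- by move=> p; rewrite divr_ge0// ltW.
- exact: measurable_funM.
- move=> p e e0; have es : (0 < e * s)%R by rewrite mulr_gt0.
  apply: (filterS _ (lip p _ es)) => q h.
  rewrite -mulrBl normrM (gtr0_norm (_ : 0 < s^-1)%R) ?invr_gt0// ler_pdivrMr//.
  by apply: le_trans h _; rewrite mulrAC ler_wpM2r// mulrDl divfK// gt_eqF.
- by move=> p /off[-> ->]; rewrite !mul0r.
- have s2 : (0 < s ^+ 2)%R by rewrite exprn_gt0.
  under eq_integral do rewrite exprMn exprVn mulrC EFinM.
  rewrite ge0_integralZl//; last 3 first.
  + by apply/measurable_EFinP; apply: measurable_funX.
  + by move=> p _; rewrite lee_fin sqr_ge0.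
  + by rewrite lee_fin invr_ge0 ltW.
  by rewrite muleC lee_pdivrMr// mul1e.
Qed.

(** The function [g = f \o Psi], extended by zero outside [B], has pointwise
    Lipschitz constant at most [G = 4 * N (Psi q) / lam (Psi q)]. The change of
    variables along [Psi] bounds the integral of [G ^ 2] by [16 * 256] times
    that of [N ^ 2], so [g / s] and [G / s] satisfy [sobolev_pair]; the change
    of variables along [Phi] brings the bound back to [A]. *)
Lemma chart_sobolev (r : R) : (0 < r)%R -> exists2 K : R, (0 < K)%R &
  forall A B Phi Psi lam (f N : plane -> R) (C : set (R * R)) (s : R),
  quasi_conformal_chart A B Phi Psi lam ->
  (exists p0, ~ A p0) -> (forall q : R * R, B q -> `|q| <= 1)%R ->
  (forall p, 0 <= N p)%R -> measurable_fun setT N ->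
  (forall p : R * R, A p -> lip_at (f : R * R -> R) p (N p)) ->
  compact C -> C `<=` A -> (forall p, ~ C p -> f p = 0%R) ->
  (0 < s)%R -> (16 * 256)%:E * \int[mu2]_(p in A) (N p ^+ 2)%:E <= (s ^+ 2)%:E ->
  \int[mu2]_(p in A) (`|f p| `^ r * lam p ^+ 2)%:E <= (K * s `^ r)%:E.
Proof.
move=> r0; have [K K0 hK] := @power_bound R _ (ltW r0).
exists (256 * K)%R; first by rewrite mulr_gt0 ?ltr0n.
move=> A B Phi Psi lam f N C s chart nA Bbox N0 mN lipf cC CA f0 s0 hs.
have ichart := chart_inv chart.
have [oA oB hPhi hPsi cPhi cPsi mlam lam0 low up] := chart.
have [_ _ _ _ _ _ mlam' lam'0 _ up'] := ichart.
have nB : exists p0, ~ B p0.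
  exists (2, 2)%R => /Bbox; rewrite norm_pairE/= ge_max => /andP[].
  by rewrite ger0_norm//; lra.
have mA : measurable (A : set plane) := open_measurable_plane oA.
have mB : measurable (B : set plane) := open_measurable_plane oB.
pose g (q : plane) : R := if q \in B then f (Psi q) else 0%R.
pose G (q : plane) : R := if q \in B then (4 * (lam (Psi q))^-1 * N (Psi q))%R else 0%R.
have gB q : B q -> g q = f (Psi q) by move=> Bq; rewrite /g mem_set.
have GB q : B q -> G q = (4 * (lam (Psi q))^-1 * N (Psi q))%R by move=> Bq; rewrite /G mem_set.
have gNB q : ~ B q -> g q = 0%R by move=> Bq; rewrite /g memNset.
have GNB q : ~ B q -> G q = 0%R by move=> Bq; rewrite /G memNset.
have G0 q : (0 <= G q)%R.
  rewrite /G; case: ifPn => // /set_mem Bq; rewrite !mulr_ge0// ltW//; exact: lam'0.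
have mPsi : measurable_fun (B : set plane) (Psi : plane -> plane) := measurable_fun_open_pair oB cPsi.
have mPhi : measurable_fun (A : set plane) (Phi : plane -> plane) := measurable_fun_open_pair oA cPhi.
have mNPsi : measurable_fun (B : set plane) (fun q => N (Psi q)) by exact: measurableT_comp.
have mGB : measurable_fun (B : set plane) G.
  have m1 : measurable_fun (B : set plane) (fun q : plane => 4 * (lam (Psi q))^-1 * N (Psi q))%R.
    by apply: measurable_funM => //; apply: measurable_funM.
  by apply: eq_measurable_fun m1 => q /set_mem Bq; rewrite GB.
have mG : measurable_fun setT G.
  have := (measurable_restrictT G mB).1 mGB; apply: eq_measurable_fun => q _.
  by rewrite patchE; case: ifPn => // /negP h; rewrite GNB// => /mem_set.
have lipg (q : R * R) : lip_at (g : R * R -> R) q (G q).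
  have [Bq|nBq] := pselect (B q).
    have [Ap Pp] := hPsi q Bq; have l0 := lam0 _ Ap.
    move=> e e0; rewrite GB//.
    have d0 : (0 < e * lam (Psi q) / 4)%R by rewrite divr_gt0// mulr_gt0.
    near=> q'.
    have Bq' : B q' by near: q'; move: oB; rewrite openE => /(_ _ Bq).
    rewrite !gB//.
    have h1 : (`|f (Psi q') - f (Psi q)| <= (N (Psi q) + e * lam (Psi q) / 4) * `|Psi q' - Psi q|)%R.
      by near: q'; exact: (cPsi _ Bq _ (lipf _ Ap _ d0)).
    have h2 : (`|Psi q' - Psi q| <= 4 * (lam (Psi q))^-1 * `|q' - q|)%R.
      by near: q'; exact: up'.
    apply: le_trans h1 _.
    apply: (@le_trans _ _ ((N (Psi q) + e * lam (Psi q) / 4) * (4 * (lam (Psi q))^-1 * `|q' - q|))%R).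
      by apply: ler_wpM2l => //; rewrite addr_ge0// ltW.
    rewrite mulrA; apply: ler_wpM2r => //; rewrite le_eqVlt; apply/orP; left; apply/eqP.
    by field; rewrite gt_eqF.
  move=> e e0; rewrite GNB// add0r.
  (* Outside [B] the function vanishes near [q], because its support lies in the
     compact image of [C]. *)
  have cl : closed (Phi @` C).
    apply: compact_closed; first exact: norm_hausdorff.
    apply: continuous_compact => //; apply: continuous_in_subspaceT => p /set_mem Cp.
    by apply: cPhi; exact: CA.
  have nq : (~` (Phi @` C)) q by move=> [p Cp e1]; apply: nBq; rewrite -e1; exact: (hPhi p (CA _ Cp)).1.
  have onq : open (~` (Phi @` C)) by exact: closed_openC.
  have gz q' : (~` (Phi @` C)) q' -> g q' = 0%R.
    move=> nq'; have [Bq'|/gNB//] := pselect (B q').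
    rewrite gB// f0// => Cq'; apply: nq'; exists (Psi q') => //; exact: (hPsi _ Bq').2.
  move: onq; rewrite openE => /(_ _ nq); apply: filterS => q' nq'.
  by rewrite !gz// subrr normr0 mulr_ge0// ltW.
have off (q : R * R) : (1 < `|q|)%R -> g q = 0%R /\ G q = 0%R.
  by move=> q1; have nBq : ~ B q by [move=> /Bbox; rewrite leNgt q1]; split; [exact: gNB|exact: GNB].
have GI : \int[mu2]_q (G q ^+ 2)%:E <= (s ^+ 2)%:E.
  apply: le_trans hs.
  have -> : \int[mu2]_q (G q ^+ 2)%:E = \int[mu2]_(q in B)
      (16%:E * ((N (Psi q) ^+ 2)%:E * ((lam (Psi q))^-1 ^+ 2)%:E)).
    rewrite [RHS]integral_mkcond; apply: eq_integral => q _; rewrite patchE.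
    case: ifPn => [/set_mem Bq|/negP Bq]; last by rewrite GNB ?expr0n// => /mem_set.
    by rewrite GB// -!EFinM; congr EFin; ring.
  have mN2 : measurable_fun (A : set plane) (fun p : plane => (N p ^+ 2)%:E).
    by apply: measurable_funTS; apply/measurable_EFinP; apply: measurable_funX.
  have N20 p : 0 <= (N p ^+ 2)%:E by rewrite lee_fin sqr_ge0.
  have H := chart_integral_le ichart nA mN2 N20.
  rewrite ge0_integralZl//; last 2 first.
  - apply: emeasurable_funM; apply/measurable_EFinP; apply: measurable_funX => //.
  - by move=> q _; rewrite mule_ge0// lee_fin sqr_ge0.
  rewrite EFinM -muleA; apply: lee_wpmul2l => //; exact: H.
have hr := hK _ _ (sobolev_pair_scale s0 G0 mG lipg off GI).
have mg : measurable_fun setT g := measurable_lip lipg.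
have mgr : measurable_fun setT (fun q : plane => (`|g q| `^ r)%:E).
  apply/measurable_EFinP.
  have h1 : measurable_fun setT (fun p : plane => `|g p|%R) by exact: measurableT_comp.
  exact: (measurableT_comp (measurable_powR r) h1).
have mgrB : measurable_fun (B : set plane) (fun q : plane => (`|g q| `^ r)%:E).
  exact: measurable_funTS.
have gr0 q : 0 <= (`|g q| `^ r)%:E by rewrite lee_fin powR_ge0.
have -> : \int[mu2]_(p in A) (`|f p| `^ r * lam p ^+ 2)%:E =
    \int[mu2]_(p in A) ((`|g (Phi p)| `^ r)%:E * (lam p ^+ 2)%:E).
  apply: eq_integral => p /set_mem Ap; rewrite EFinM.
  by have [Bp e] := hPhi p Ap; rewrite gB// e.
apply: le_trans (chart_integral_le chart nB mgrB gr0) _.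
rewrite -mulrA EFinM; apply: lee_wpmul2l => //.
apply: (@le_trans _ _ (\int[mu2]_(q in box) (`|g q| `^ r)%:E)).
  apply: ge0_subset_integral => //; first exact: measurable_box.
  exact: measurable_funTS.
have sr0 : (0 < s `^ r)%R by rewrite powR_gt0.
have -> : \int[mu2]_(q in box) (`|g q| `^ r)%:E =
    \int[mu2]_(q in box) ((s `^ r)%:E * (`|g q / s| `^ r)%:E).
  apply: eq_integral => q _; rewrite -EFinM -powRM// ?ltW//.
  by rewrite normrM [`|s^-1|%R]gtr0_norm ?invr_gt0// mulrCA divff ?mulr1// gt_eqF.
rewrite ge0_integralZl; last 4 first.
- exact: measurable_box.
- apply: measurable_funTS; apply/measurable_EFinP.
  have h1 : measurable_fun setT (fun p : plane => `|g p / s|%R).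
    by apply: measurableT_comp => //; exact: measurable_funM.
  exact: (measurableT_comp (measurable_powR r) h1).
- by move=> p _; rewrite lee_fin powR_ge0.
- by rewrite lee_fin ltW.
by rewrite muleC EFinM; apply: lee_wpmul2r => //; rewrite lee_fin ltW.
Unshelve. all: by end_near. Qed.

End Transfer.

(** * The complex plane as a real plane *)

Section Complex.
Context {R : realType}.
Local Notation normc := ComplexField.Normc.normc.
Implicit Types (z w : cplx R) (p q : R * R).

Definition to_plane (z : cplx R) : R * R := (complex.Re z, complex.Im z).

Lemma to_planeK z : of_plane (to_plane z) = z.
Proof. by case: z. Qed.
Lemma of_planeK p : to_plane (of_plane p) = p.
Proof. by case: p. Qed.

Lemma normE z : `|z| = (normc z)%:C%C :> R[i].
Proof. by case: z. Qed.

Lemma normc_ge_sup z : `|to_plane z| <= normc z.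
Proof.
case: z => a b; rewrite norm_pairE ge_max /= -!sqrtr_sqr.
by rewrite !ler_wsqrtr// ?lerDl ?lerDr sqr_ge0.
Qed.

Lemma normc_le_sup z : normc z <= 2 * `|to_plane z|.
Proof.
case: z => a b; rewrite norm_pairE /=; set m := Num.max _ _.
have ha : `|a| <= m by rewrite le_max lexx.
have hb : `|b| <= m by rewrite le_max lexx orbT.
have m0 : 0 <= m by apply: le_trans ha.
rewrite -[leRHS]ger0_norm ?mulr_ge0// -sqrtr_sqr ler_wsqrtr//.
rewrite -[a ^+ 2]real_normK ?num_real// -[b ^+ 2]real_normK ?num_real//.
have := normr_ge0 a; have := normr_ge0 b; nra.
Qed.

Lemma normc_opp z : normc (- z) = normc z.
Proof. by apply/eqP; rewrite -(inj_eq (@complexI R)) -!normE normrN. Qed.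

Lemma normc_ge0 z : 0 <= normc z.
Proof. by case: z => a b; exact: sqrtr_ge0. Qed.

Lemma normc_triangle z w : normc (z + w) <= normc z + normc w.
Proof. by rewrite -lecR rmorphD/= -!normE ler_normD. Qed.

Lemma near_cplxP z (P : cplx R -> Prop) :
  (\forall w \near z, P w) <-> exists2 e : R, 0 < e & forall w, normc (w - z) < e -> P w.
Proof.
split.
  move=> /nbhs_ballP[e /= e0 he].
  have er : (complex.Re e)%:C%C = e by rewrite RRe_real ?gtr0_real.
  exists (complex.Re e); first by rewrite -ltcR er.
  move=> w hw; apply: he; rewrite /ball/= -er distrC normE ltcR.
  exact: hw.
move=> [e e0 he]; apply/nbhs_ballP; exists (e%:C)%C; first by rewrite /= ltcR.
by move=> w; rewrite /ball/= distrC normE ltcR => h; exact: he.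
Qed.

Lemma of_planeB p q : of_plane p - of_plane q = of_plane (p - q) :> cplx R.
Proof. by case: p q => [a b] [c d]; rewrite /of_plane/=; simpc. Qed.

Lemma to_planeB z w : to_plane z - to_plane w = to_plane (z - w).
Proof. by case: z w => [a b] [c d]. Qed.

Lemma of_plane_continuous : continuous (of_plane : R * R -> cplx R).
Proof.
move=> p P /near_cplxP[e e0 he].
have e2 : 0 < e / 2 by rewrite divr_gt0.
apply/nbhs_ballP; exists (e / 2) => // q; rewrite -ball_normE /= distrC => h.
apply: he; rewrite of_planeB; apply: le_lt_trans (normc_le_sup _) _.
by rewrite of_planeK mulrC -ltr_pdivlMr.
Qed.

Lemma to_plane_continuous : continuous to_plane.
Proof.
move=> z P /nbhs_ballP[e /= e0 he]; apply/near_cplxP; exists e => // w h.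
apply: he; rewrite -ball_normE/= distrC to_planeB.
exact: le_lt_trans (normc_ge_sup _) h.
Qed.

(** The complex derivative as a first order expansion, in the real norm. *)
Lemma derivable_approx (phi : cplx R -> cplx R) z (e : R) : 0 < e -> derivable phi z 1 ->
  \forall w \near z, normc (phi w - phi z - derive1 phi z * (w - z)) <= e * normc (w - z).
Proof.
move=> e0 dphi.
have H : (h^-1 *: (phi (h *: 1 + z) - phi z)) @[h --> (0 : cplx R)^'] --> (derive1 phi z : cplx R).
  by rewrite derive1E.
have ec : 0 < e%:C%C :> R[i] by rewrite ltcR.
move/cvgrPdist_le : H => H.
have /near_cplxP[d d0 hd] : \forall h \near (0 : cplx R), h != 0 ->
  `|(derive1 phi z : cplx R) - h^-1 *: (phi (h *: 1 + z) - phi z)| <= e%:C%C := H _ ec.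
apply/near_cplxP; exists d => // w hw.
have [->|wz] := eqVneq w z.
  by rewrite !subrr mulr0 subr0 ComplexField.Normc.normc0 mulr0.
have := hd (w - z); rewrite subr0 subr_eq0 => /(_ hw wz).
have -> : ((w - z) *: 1 + z : cplx R) = w by rewrite /GRing.scale/= mulr1 subrK.
move=> h.
have wz' : (w - z : R[i]) != 0 by rewrite subr_eq0.
have -> : phi w - phi z - derive1 phi z * (w - z) = 
   - ((w - z) * (derive1 phi z - (w - z)^-1 *: (phi w - phi z))).
  have alg (a b c : R[i]) : c != 0 -> b - a * c = - (c * (a - c^-1 * b)).
    by move=> c0; rewrite mulrBr mulrA mulfV// mul1r opprB [c * a]mulrC.
  exact: alg wz'.
rewrite normc_opp ComplexField.Normc.normcM mulrC ler_wpM2r ?normc_ge0//.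
by rewrite -lecR -normE.
Qed.

End Complex.

(** * Conformal homeomorphisms as charts *)

Section Chart.
Context {R : realType}.
Local Notation normc := ComplexField.Normc.normc.
Local Notation plane := (measurableTypeR R * measurableTypeR R)%type.
Implicit Types (z w : cplx R) (p q : R * R).

Lemma unit_disc_open : open (unit_disc : set (cplx R)).
Proof.
rewrite openE => z; rewrite /unit_disc/= /interior => z1.
apply/near_cplxP; exists (1 - normc z); first by rewrite subr_gt0.
move=> w; rewrite ltrBrDr; apply: le_lt_trans.
by rewrite -[w in leLHS](subrK z); exact: normc_triangle.
Qed.

Definition on_plane (phi : cplx R -> cplx R) p := to_plane (phi (of_plane p)).

Lemma on_plane_continuous phi p : {for of_plane p, continuous phi} ->
  {for p, continuous (on_plane phi)}.
Proof.
move=> c; apply: (@continuous_comp _ _ _ (phi \o of_plane) to_plane); last exact: to_plane_continuous.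
by apply: continuous_comp; first exact: of_plane_continuous.
Qed.

Lemma within_open_continuous (A : set (cplx R)) (phi : cplx R -> cplx R) z : open A -> A z ->
  {within A, continuous phi} -> {for z, continuous phi}.
Proof. by move=> oA Az; rewrite continuous_open_subspace// => c; apply: c; exact: mem_set. Qed.

(** The expansion with error [l / 4] keeps the Euclidean dilation between
    [3 / 4 * l] and [5 / 4 * l], and the Euclidean norm is between the maximum
    norm and twice the maximum norm. *)
Lemma derivable_bounds (phi : cplx R -> cplx R) p :
  derivable phi (of_plane p) 1 -> derive1 phi (of_plane p) != 0 ->
  let l := normc (derive1 phi (of_plane p)) in
  \forall q \near p, l * `|q - p| <= 4 * `|on_plane phi q - on_plane phi p| /\
    `|on_plane phi q - on_plane phi p| <= 4 * l * `|q - p|.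
Proof.
move=> dphi nz l.
have l0 : 0 < l.
  rewrite lt0r normc_ge0 andbT; apply: contra_neq nz.
  exact: ComplexField.Normc.eq0_normc.
have e0 : 0 < l / 4 by rewrite divr_gt0.
have H := of_plane_continuous (derivable_approx e0 dphi).
have {}H : \forall q \near p, normc (phi (of_plane q) - phi (of_plane p) -
   derive1 phi (of_plane p) * (of_plane q - of_plane p)) <=
   l / 4 * normc (of_plane q - of_plane p) := H.
apply: (filterS _ H) => q; rewrite /on_plane to_planeB.
set D := phi (of_plane q) - _; set d := of_plane q - of_plane p.
have -> : q - p = to_plane d by rewrite /d of_planeB of_planeK.
set a := derive1 phi (of_plane p) => h.
have lE : normc (a * d) = l * normc d by rewrite ComplexField.Normc.normcM.
have h1 : normc D <= normc (D - a * d) + normc (a * d).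
  by rewrite -{1}[D](subrK (a * d)); exact: normc_triangle.
have h2 : normc (a * d) <= normc (D - a * d) + normc D.
  have e : a * d = - (D - a * d) + D by rewrite opprB subrK.
  by rewrite [in leLHS]e -(normc_opp (D - a * d)); exact: normc_triangle.
have d1 := normc_ge_sup d; have d2 := normc_le_sup d.
have D1 := normc_ge_sup D; have D2 := normc_le_sup D.
have p1 : l * `|to_plane d| <= l * normc d by rewrite ler_wpM2l// ltW.
have p2 : l * normc d <= l * (2 * `|to_plane d|) by rewrite ler_wpM2l// ltW.
have n0 := normr_ge0 (to_plane d); have n1 := normr_ge0 (to_plane D).
have n2 : 0 <= l * `|to_plane d| by rewrite mulr_ge0// ltW.
by split; lra.
Qed.

(** The dilation is the limit of the difference quotients along the real
    increments [n.+1%:R^-1]. The functions are cut off outside [A] to be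
    measurable on the whole plane; on [A], which is open, this does not affect
    the limit. *)
Lemma normc_derive_measurable (A : set (cplx R)) (phi : cplx R -> cplx R) :
  open A -> (forall z, A z -> {for z, continuous phi}) ->
  (forall z, A z -> derivable phi z 1) ->
  measurable_fun (of_plane @^-1` A : set plane)
    (fun p : plane => normc (derive1 phi (of_plane p))).
Proof.
move=> oA cphi dphi.
pose B : set (R * R) := of_plane @^-1` A.
have oB : open B by apply: open_comp => // p _; exact: of_plane_continuous.
have mB : measurable (B : set plane) := open_measurable_plane oB.
pose F1 : plane -> R := (fun p => (on_plane phi p).1) \_ B.
pose F2 : plane -> R := (fun p => (on_plane phi p).2) \_ B.
have cP p : B p -> {for p, continuous (on_plane phi)}.
  by move=> Bp; apply: on_plane_continuous; exact: cphi.
have mF1 : measurable_fun setT F1.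
  apply/(measurable_restrictT _ mB).
  exact: (measurable_fun_open oB (fun p Bp => continuous_fst_comp (cP p Bp))).
have mF2 : measurable_fun setT F2.
  apply/(measurable_restrictT _ mB).
  exact: (measurable_fun_open oB (fun p Bp => continuous_snd_comp (cP p Bp))).
pose sh n (p : plane) : plane := (p.1 + n.+1%:R^-1, p.2).
have msh n : measurable_fun setT (sh n).
  apply: measurable_fun_pair => //.
  by apply: measurable_funD => //; exact: measurable_fst.
pose Q n (p : plane) : R :=
  n.+1%:R * Num.sqrt ((F1 (sh n p) - F1 p) ^+ 2 + (F2 (sh n p) - F2 p) ^+ 2).
apply: (measurable_fun_cvg _ (h := Q)) => //.
  move=> n; apply: measurable_funTS; apply: measurable_funM => //.
  have ms : measurable_fun setT (@Num.sqrt R).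
    by apply: continuous_measurable_fun; exact: sqrt_continuous.
  apply: (measurableT_comp ms); apply: measurable_funD; apply: measurable_funX;
    apply: measurable_funB => //.
    exact: measurableT_comp.
  exact: measurableT_comp.
move=> p Bp; apply/cvgrPdist_le => e e0.
have H := of_plane_continuous (derivable_approx e0 (dphi _ Bp)).
have cs : (sh n p : R * R) @[n --> \oo] --> (p : R * R).
  have c1 : (p.1 + n.+1%:R^-1) @[n --> \oo] --> p.1.
    rewrite -[X in _ --> X]addr0; apply: cvgD; first exact: cvg_cst.
    exact: cvg_harmonic.
  exact: (cvg_pair c1 (cvg_cst p.2)).
have oBp : \forall q \near (p : R * R), B q by move: oB; rewrite openE => /(_ _ Bp).
have {}H : \forall n \near \oo, normc (phi (of_plane (sh n p)) - phi (of_plane p) -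
   derive1 phi (of_plane p) * (of_plane (sh n p) - of_plane p)) <=
   e * normc (of_plane (sh n p) - of_plane p) := cs _ H.
have {}oBp : \forall n \near \oo, B (sh n p) := cs _ oBp.
near=> n.
have Bn : B (sh n p) by near: n.
have h : normc (phi (of_plane (sh n p)) - phi (of_plane p) -
   derive1 phi (of_plane p) * (of_plane (sh n p) - of_plane p)) <=
   e * normc (of_plane (sh n p) - of_plane p).
  by near: n.
have dE : of_plane (sh n p) - of_plane p = (n.+1%:R^-1)%:C%C :> cplx R.
  by rewrite of_planeB /sh /of_plane /=; rewrite addrAC subrr add0r subrr.
have nE : normc ((n.+1%:R^-1)%:C%C : R[i]) = n.+1%:R^-1.
  by rewrite /normc/= expr0n/= addr0 sqrtr_sqr ger0_norm.
have QE : Q n p = n.+1%:R * normc (phi (of_plane (sh n p)) - phi (of_plane p)).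
  rewrite /Q /F1 /F2 !patchE !mem_set// /on_plane.
  by congr (_ * _); case: (phi _) => a b; case: (phi _) => c d.
rewrite QE; move: h; rewrite dE nE.
set a := derive1 _ _; set D := phi _ - _ => h.
have n0 : 0 < n.+1%:R :> R by [].
have aE : normc (a * (n.+1%:R^-1)%:C%C) = normc a / n.+1%:R by rewrite ComplexField.Normc.normcM nE.
have h1 : normc D <= normc (D - a * (n.+1%:R^-1)%:C%C) + normc (a * (n.+1%:R^-1)%:C%C).
  by rewrite -{1}[D](subrK (a * (n.+1%:R^-1)%:C%C)); exact: normc_triangle.
have h2 : normc (a * (n.+1%:R^-1)%:C%C) <= normc (D - a * (n.+1%:R^-1)%:C%C) + normc D.
  have eq : a * (n.+1%:R^-1)%:C%C = - (D - a * (n.+1%:R^-1)%:C%C) + D by rewrite opprB subrK.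
  by rewrite [in leLHS]eq -(normc_opp (D - a * _)); exact: normc_triangle.
rewrite aE in h1 h2.
rewrite ler_distl.
have -> : normc a = n.+1%:R * (normc a / n.+1%:R) by rewrite mulrCA mulfV ?mulr1.
have -> : e = n.+1%:R * (e / n.+1%:R) by rewrite mulrCA mulfV ?mulr1.
rewrite -mulrBr -mulrDr !ler_pM2l//; apply/andP; split.
  by rewrite lerBlDl; apply: le_trans h1 _; rewrite lerD2r.
by rewrite addrC; apply: le_trans h2 _; rewrite lerD2r.
Unshelve. all: by end_near. Qed.

Lemma conformal_chart (Omega : set (cplx R)) phi : open Omega ->
  conformal_homeomorphism Omega unit_disc phi ->
  exists Psi, quasi_conformal_chart (of_plane @^-1` Omega) (of_plane @^-1` unit_disc)
    (on_plane phi) Psi (fun p => normc (derive1 phi (of_plane p))).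
Proof.
move=> oO [[[phiB phiI phiS] cphi [psi psiK cpsi]] hd].
have phi_cont z : Omega z -> {for z, continuous phi}.
  by move=> Oz; exact: within_open_continuous oO Oz cphi.
have psi_cont z : unit_disc z -> {for z, continuous psi}.
  by move=> Oz; exact: within_open_continuous unit_disc_open Oz cpsi.
have pre_open (U : set (cplx R)) : open U -> open (of_plane @^-1` U : set (R * R)).
  by move=> oU; apply: open_comp => // p _; exact: of_plane_continuous.
exists (on_plane psi); split.
- exact: pre_open.
- exact: pre_open unit_disc_open.
- move=> p Op; split; rewrite /on_plane/= to_planeK; first exact: phiB.
  by rewrite psiK ?inE// of_planeK.
- move=> q /phiS[z Oz e]; rewrite /on_plane/= to_planeK -e psiK ?inE//.
  by split => //; rewrite e of_planeK.
- by move=> p Op; apply: on_plane_continuous; exact: phi_cont.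
- by move=> p Op; apply: on_plane_continuous; exact: psi_cont.
- exact: (normc_derive_measurable oO phi_cont (fun z Oz => (hd z Oz).1)).
- move=> p Op; rewrite lt0r normc_ge0 andbT; apply: contra_neq (hd _ Op).2.
  exact: ComplexField.Normc.eq0_normc.
- move=> p Op; apply: (filterS _ (derivable_bounds (hd _ Op).1 (hd _ Op).2)).
  by move=> q [].
- move=> p Op; apply: (filterS _ (derivable_bounds (hd _ Op).1 (hd _ Op).2)).
  by move=> q [].
Qed.

End Chart.

(** * Gradients and the theorem *)

Section Final.
Context {R : realType}.
Local Notation normc := ComplexField.Normc.normc.
Local Notation mu := (@lebesgue_measure R).
Local Notation mu2 := (mu \x mu)%E.
Local Notation plane := (measurableTypeR R * measurableTypeR R)%type.

(** Mean value theorem without an order between the endpoints. *)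
Lemma mvt_between (F : R -> R) a b : (forall x, derivable F x 1) ->
  exists2 c, `|c - a| <= `|b - a| & F b - F a = derive1 F c * (b - a).
Proof.
move=> dF.
have isd (x : R) : is_derive x 1 F (derive1 F x) by rewrite derive1E; exact: DeriveDef.
have cF (x : R) : {for x, continuous F} by apply: differentiable_continuous; exact/derivable1_diffP.
have [ab|/ltW ba] := leP a b.
  have cab : {within `[a, b], continuous F} by apply: continuous_subspaceT => x; exact: cF.
  have [c] := MVT_segment ab (fun x _ => isd x) cab.
  rewrite in_itv/= => hc ->; exists c => //.
  by rewrite !ger0_norm; lra.
have cba : {within `[b, a], continuous F} by apply: continuous_subspaceT => x; exact: cF.
have [c] := MVT_segment ba (fun x _ => isd x) cba.
rewrite in_itv/= => hc h; exists c.
  by rewrite !ler0_norm; lra.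
by rewrite -opprB h; ring.
Qed.

Definition l1grad (f : cplx R -> R) (p : plane) : R :=
  `|partial_x f (of_plane p)| + `|partial_y f (of_plane p)|.

(** Join two points by a horizontal and a vertical segment and apply the mean
    value theorem on each. *)
Lemma class_C1_lip_at (f : cplx R -> R) (p : R * R) : class_C 1 f ->
  lip_at (f \o of_plane : R * R -> R) p (l1grad f p).
Proof.
move=> [cf [dx dy [cx _] [cy _]]] e e0.
have e2 : 0 < e / 2 by rewrite divr_gt0.
have cx' : {for p, continuous (partial_x f \o of_plane : R * R -> R)}.
  by apply: continuous_comp; [exact: of_plane_continuous|exact: cx].
have cy' : {for p, continuous (partial_y f \o of_plane : R * R -> R)}.
  by apply: continuous_comp; [exact: of_plane_continuous|exact: cy].
have /nbhs_ballP[d1 /= d10 h1] : \forall q \near p,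
    `|partial_x f (of_plane q)| <= `|partial_x f (of_plane p)| + e / 2.
  move/cvgrPdist_le : cx' => /(_ _ e2); apply: filterS => q /= h.
  rewrite -[in leLHS](subrK (partial_x f (of_plane p)) (partial_x f (of_plane q))).
  by apply: le_trans (ler_normD _ _) _; rewrite addrC lerD2l distrC.
have /nbhs_ballP[d2 /= d20 h2] : \forall q \near p,
    `|partial_y f (of_plane q)| <= `|partial_y f (of_plane p)| + e / 2.
  move/cvgrPdist_le : cy' => /(_ _ e2); apply: filterS => q /= h.
  rewrite -[in leLHS](subrK (partial_y f (of_plane p)) (partial_y f (of_plane q))).
  by apply: le_trans (ler_normD _ _) _; rewrite addrC lerD2l distrC.
have d0 : 0 < Num.min d1 d2 by rewrite lt_min d10.
apply/nbhs_ballP; exists (Num.min d1 d2) => //= q.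
rewrite -ball_normE /= distrC lt_min => /andP[qd1 qd2].
case: p q h1 h2 qd1 qd2 {cx' cy'} => [x0 y0] [x y] /= h1 h2 qd1 qd2.
have [c cx1 ex] := @mvt_between (fun t => f (t +i* y)%C) x0 x (fun t => dx (t +i* y)%C).
have [k cy1 ey] := @mvt_between (fun t => f (x0 +i* t)%C) y0 y (fun t => dy (x0 +i* t)%C).
have nx : `|x - x0| <= `|(x, y) - (x0, y0)| by rewrite norm_pairE le_max lexx.
have ny : `|y - y0| <= `|(x, y) - (x0, y0)| by rewrite norm_pairE le_max lexx orbT.
have b1 : `|partial_x f (c +i* y)%C| <= `|partial_x f (x0 +i* y0)%C| + e / 2.
  apply: (h1 (c, y)); rewrite -ball_normE /= distrC.
  by apply: le_lt_trans qd1; rewrite !norm_pairE/= ge_max !le_max cx1 lexx orbT.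
have b2 : `|partial_y f (x0 +i* k)%C| <= `|partial_y f (x0 +i* y0)%C| + e / 2.
  apply: (h2 (x0, k)); rewrite -ball_normE /= distrC.
  by apply: le_lt_trans qd2; rewrite !norm_pairE/= ge_max !le_max subrr normr0 normr_ge0 cy1 orbT.
rewrite /of_plane/= (_ : f (x +i* y)%C - f (x0 +i* y0)%C =
  (f (x +i* y)%C - f (x0 +i* y)%C) + (f (x0 +i* y)%C - f (x0 +i* y0)%C)); last by rewrite addrA subrK.
rewrite ex ey; apply: le_trans (ler_normD _ _) _; rewrite !normrM.
rewrite /l1grad /of_plane/=.
rewrite (_ : _ + _ + e =
  (`|partial_x f (x0 +i* y0)%C| + e / 2) + (`|partial_y f (x0 +i* y0)%C| + e / 2)); last by lra.
by rewrite mulrDl; apply: lerD; apply: ler_pM.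
Qed.

Lemma l1grad_sqr_le (f : cplx R -> R) (p : plane) :
  l1grad f p ^+ 2 <= 2 * enorm (gradient f (of_plane p)) ^+ 2.
Proof.
rewrite /enorm /gradient /= sqr_sqrtr ?addr_ge0 ?sqr_ge0// /l1grad.
rewrite -[partial_x f _ ^+ 2]real_normK ?num_real// -[partial_y f _ ^+ 2]real_normK ?num_real//.
set a := `|_|; set b := `|_|; have := sqr_ge0 (a - b); nra.
Qed.

Lemma class_C1_measurable (f : cplx R -> R) : class_C 1 f ->
  measurable_fun setT (fun p : plane => partial_x f (of_plane p)) /\
  measurable_fun setT (fun p : plane => partial_y f (of_plane p)).
Proof.
move=> [cf [dx dy [cx _] [cy _]]]; split.
- apply: (@measurable_fun_open R setT) => [|p _]; first exact: openT.
  by apply: (@continuous_comp _ _ _ of_plane (partial_x f)); [exact: of_plane_continuous|exact: cx].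
- apply: (@measurable_fun_open R setT) => [|p _]; first exact: openT.
  by apply: (@continuous_comp _ _ _ of_plane (partial_y f)); [exact: of_plane_continuous|exact: cy].
Qed.

Lemma boundary_proper (A : set (cplx R)) : boundary A !=set0 -> exists p : R * R, ~ A (of_plane p).
Proof.
move=> [z [_ nz]]; apply: contrapT => h; apply: nz.
have -> : A = setT.
  apply/seteqP; split => // w _; apply: contrapT => nw; apply: h.
  by exists (to_plane w); rewrite to_planeK.
by rewrite interiorT.
Qed.

End Final.

Theorem theorem3p3 (R : realType) (r : R) (hr : 1 <= r) :
  exists K : R,
    forall (Omega : set (cplx R)) (phi : cplx R -> cplx R),
      simply_connected_domain Omega ->
      boundary Omega !=set0 ->
      conformal_homeomorphism Omega unit_disc phi ->
      let h := conformal_weight phi in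
      forall f : cplx R -> R, C0infty Omega f ->
        (plane_integral Omega (fun z => `|f z| `^ r * h z)%R `^ r^-1 <=
         K%:E *
         plane_integral Omega (fun z => enorm (gradient f z) ^+ 2)%R `^ 2^-1)%E.
Proof.
have r0 : 0 < r by apply: lt_le_trans hr.
have [K K0 hK] := @chart_sobolev R r r0.
pose k := K `^ r^-1; have k0 : 0 < k by rewrite powR_gt0.
pose c : R := 16 * 256 * 2; have c0 : 0 < c by rewrite !mulr_gt0 ?ltr0n.
pose S := Num.sqrt c; have S0 : 0 < S by rewrite sqrtr_gt0.
exists (k * S) => Omega phi [[oO _ _] _] bO cphi h f [sf cf fO].
have [Psi chart] := conformal_chart oO cphi.
set A := of_plane @^-1` Omega in chart.
set lam := (fun p : R * R => _) in chart.
pose plane := (measurableTypeR R * measurableTypeR R)%type.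
have nA : exists p0, ~ A p0 by exact: boundary_proper bO.
have Bbox (q : R * R) : (of_plane @^-1` unit_disc) q -> `|q| <= 1.
  by rewrite /unit_disc/= => /ltW; apply: le_trans; rewrite -{1}[q]of_planeK; exact: normc_ge_sup.
have f1 := sf 1%N.
have [mx my] := class_C1_measurable f1.
have oA : open A by have [] := chart.
have mA : measurable (A : set plane) := open_measurable_plane oA.
pose C := to_plane @` tsupport f.
have cC : compact C.
  apply: continuous_compact => //; apply: continuous_subspaceT; exact: to_plane_continuous.
have CA : C `<=` A by move=> _ [z fz <-]; rewrite /A/= to_planeK; exact: fO.
have f0 (p : R * R) : ~ C p -> f (of_plane p) = 0.
  move=> nC; apply: contrapT => /eqP nf; apply: nC; exists (of_plane p); last exact: of_planeK.
  exact: subset_closure.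
have mN : measurable_fun setT (l1grad f).
  by apply: measurable_funD; exact: measurableT_comp.
have N0 p : 0 <= l1grad f p by rewrite addr_ge0.
set X := plane_integral Omega _; set Y := plane_integral Omega _.
have Y0 : (0 <= Y)%E by apply: integral_ge0 => p _; rewrite lee_fin sqr_ge0.
have XE : X = (\int[lebesgue_measure \x lebesgue_measure]_(p in A)
    (`|f (of_plane p)| `^ r * lam p ^+ 2)%:E)%E.
  apply: eq_integral => p /set_mem Ap; rewrite /h conformal_weightE//.
  exact: (cphi.2 _ Ap).1.
have X0 : (0 <= X)%E.
  by rewrite XE; apply: integral_ge0 => p _; rewrite lee_fin mulr_ge0 ?powR_ge0 ?sqr_ge0.
have NY : (\int[lebesgue_measure \x lebesgue_measure]_(p in A) (l1grad f p ^+ 2)%:E <= 2%:E * Y)%E.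
  rewrite /Y /plane_integral -/A.
  have me : measurable_fun (A : set plane) (fun p : plane => (enorm (gradient f (of_plane p)) ^+ 2)%:E).
    apply: measurable_funTS; apply/measurable_EFinP.
    rewrite (_ : (fun p => _) = (fun p : plane =>
        partial_x f (of_plane p) ^+ 2 + partial_y f (of_plane p) ^+ 2)).
      by apply: measurable_funD; exact: measurable_funX.
    by apply/funext => p; rewrite /enorm sqr_sqrtr// addr_ge0 ?sqr_ge0.
  rewrite -ge0_integralZl//; last by move=> p _; rewrite lee_fin sqr_ge0.
  apply: ge0_le_integral => //.
  - by move=> p _; rewrite lee_fin sqr_ge0.
  - by apply: measurable_funTS; apply/measurable_EFinP; apply: measurable_funX.
  - exact: emeasurable_funM.
  - by move=> p _; rewrite -EFinM lee_fin; exact: l1grad_sqr_le.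
(* The homogeneous form of the estimate: [s ^ 2] is any bound for a multiple of
   the Dirichlet integral. *)
have main s : 0 < s -> (c%:E * Y <= (s ^+ 2)%:E)%E -> (X `^ r^-1 <= (k * s)%:E)%E.
  move=> s0 hs.
  have XK : (X <= (K * s `^ r)%:E)%E.
    rewrite XE; apply: (hK _ _ _ _ _ _ (l1grad f) C s chart nA Bbox) => //.
    - by move=> p _; exact: class_C1_lip_at.
    - apply: le_trans hs; apply: le_trans (lee_wpmul2l _ NY) _ => //.
      by rewrite muleA -EFinM.
  have Xfin : X \is a fin_num by rewrite ge0_fin_numE// (le_lt_trans XK)// ltry.
  rewrite -(fineK Xfin) poweR_EFin lee_fin.
  have ks : k * s = (K * s `^ r) `^ r^-1.
    rewrite powRM ?powR_ge0 ?ltW// -powRrM mulfV ?gt_eqF// powRr1// ltW//.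
  rewrite ks; apply: ge0_ler_powR.
  - by rewrite invr_ge0 ltW.
  - by rewrite nnegrE fine_ge0.
  - by rewrite nnegrE mulr_ge0 ?powR_ge0// ltW.
  - by rewrite -lee_fin fineK.
have [Yoo|Yfin] := eqVneq Y +oo%E.
  by rewrite Yoo poweRyr ?gt_eqF ?invr_gt0// gt0_muley ?leey// lte_fin mulr_gt0.
have Yf : Y \is a fin_num by rewrite ge0_fin_numE// lt_neqAle Yfin leey.
set y := fine Y; have YE : Y = y%:E by rewrite fineK.
have y0 : 0 <= y by rewrite fine_ge0.
rewrite YE poweR_EFin powR12_sqrt// -EFinM.
(* The square root of the Dirichlet integral may vanish, so [s] is taken slightly
   larger. *)
apply/lee_addgt0Pr => e e0.
have ek : 0 < e / k by rewrite divr_gt0.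
have s0 : 0 < S * Num.sqrt y + e / k by rewrite ltr_wpDl// mulr_ge0 ?sqrtr_ge0// ltW.
apply: le_trans (main _ s0 _) _.
  rewrite YE -EFinM lee_fin.
  have -> : c * y = (S * Num.sqrt y) ^+ 2 by rewrite exprMn !sqr_sqrtr// ltW.
  have Sy0 : 0 <= S * Num.sqrt y by rewrite mulr_ge0 ?sqrtr_ge0// ltW.
  by rewrite ler_sqr ?nnegrE// ?lerDl; exact: ltW.
by rewrite -EFinD lee_fin mulrDr mulrA lerD2l mulrCA mulfV ?gt_eqF// mulr1.
Qed.
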